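(* For any initial time $m\ge1$ and $C\ge7$, letting $g_t := 0.85\sqrt{t^{-1}(\log\log(et/m)+C)}$, we have $$\mathbb{P}\Big(\exists t\ge m,\ p\in(0,1):\ Q^-(p)<\widehat Q^-_t(p-g_t)\ \text{ or }\ Q(p)>\widehat Q_t(p+g_t)\Big)\le 1612\,e^{-1.25C}.$$
   Context: $(X_i)_{i=1}^\infty$ is a sequence of i.i.d. observations taking values in a complete, totally ordered set $(\mathcal{X},\le)$. $F(x):=\mathbb{P}(X_1\le x)$ and $\widehat F_t(x):=t^{-1}\sum_{i=1}^t \mathbf{1}\{X_i\le x\}$ for $t\in\mathbb{N}$. The upper and lower quantile functions are $Q(p):=\sup\{x\in\mathcal{X}:F(x)\le p\}$ and $Q^-(p):=\sup\{x\in\mathcal{X}:F(x)<p\}$. The upper and lower empirical quantile functions are $\widehat Q_t(p):=\sup\{x\in\mathcal{X}:\widehat F_t(x)\le p\}$ and $\widehat Q^-_t(p):=\sup\{x\in\mathcal{X}:\widehat F_t(x)<p\}$, extended to all $p\in\mathbb{R}$ with the convention that the supremum of the empty set is $\inf\mathcal{X}$, so that $\widehat Q_t(p)=\widehat Q^-_t(p)=\inf\mathcal{X}$ for $p<0$ and $\widehat Q_t(p)=\widehat Q^-_t(p)=\sup\mathcal{X}$ for $p>1$ (for $\mathcal{X}=\mathbb{R}$ these are $-\infty$ and $+\infty$). The time index $t$ ranges over positive integers.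
   Formalization: The law of X_1 is additionally assumed continuous along monotone families of initial segments {X_1 ≤ a} (automatic for X = R); without it the claim fails, e.g. on ω_1 with the countable/co-countable 0-1 law, where F ≡ 0. *)

(* Defs.v *)
From HB Require Import structures.
From mathcomp Require Export all_boot all_order all_algebra.
From mathcomp Require Export all_classical all_reals all_analysis.

#[export] Set Implicit Arguments.
#[export] Unset Strict Implicit.
#[export] Unset Printing Implicit Defensive.
Import Order.TTheory GRing.Theory Num.Theory.
Local Open Scope classical_set_scope.
Local Open Scope ring_scope.

(* Completeness is Dedekind completeness, so that X = R qualifies. *)
Definition complete_order (d : Order.disp_t) (X : orderType d) : Prop :=
  forall A : set X, A !=set0 -> ubound A !=set0 -> supremums A !=set0.

(* X with two additional end points -oo and +oo; quantiles take their values
   here.  The alias avoids the order of \bar R, which is only available for a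
   number type R. *)
Definition with_ends (d : Order.disp_t) (X : orderType d) : Type := extended X.

HB.instance Definition _ d (X : orderType d) := Choice.on (with_ends X).

Section WithEndsOrder.
Variables (d : Order.disp_t) (X : orderType d).

Definition le_with_ends (a b : with_ends X) : bool :=
  match a, b with
  | ENInf, _ => true
  | _, EPInf => true
  | EFin x, EFin y => (x <= y)%O
  | _, _ => false
  end.

Fact le_with_ends_refl : reflexive le_with_ends.
Proof. by case=> //= x; rewrite lexx. Qed.

Fact le_with_ends_anti : antisymmetric le_with_ends.
Proof. by case=> [x||] [y||] //= /le_anti ->. Qed.

Fact le_with_ends_trans : transitive le_with_ends.
Proof. by case=> [x||] [y||] [z||] //=; apply: le_trans. Qed.

Fact le_with_ends_total : total le_with_ends.
Proof. by case=> [x||] [y||] //=; apply: le_total. Qed.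

HB.instance Definition _ := Order.Le_isPOrder.Build d (with_ends X)
  le_with_ends_refl le_with_ends_anti le_with_ends_trans.
HB.instance Definition _ := Order.POrder_isTotal.Build d (with_ends X)
  le_with_ends_total.

Definition fin_elt (x : X) : with_ends X := EFin x.

(* inf X: the minimum of X if there is one, and -oo otherwise *)
Definition inf_space : with_ends X := infimum (@EPInf X : with_ends X) (range fin_elt).

(* Suprema are least upper bounds in [with_ends X]: that of an unbounded set is
   +oo, that of X is max X if X has a maximum, and that of set0 is inf X. *)
Definition sup_in (A : set X) : with_ends X := supremum inf_space (fin_elt @` A).

(* The sigma-algebra generated by the open and closed initial segments.  It is
   contained in the Borel sigma-algebra of the order topology, hence Borel
   i.i.d. observations are i.i.d. in the sense of [iid] below. *)
Definition order_measurable : set (set X) :=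
  <<s [set B | exists a : X, B = [set x | (x <= a)%O] \/ B = [set x | (x < a)%O]] >>.

End WithEndsOrder.

Section Quantiles.
Variables (R : realType) (d : Order.disp_t) (X : orderType d).

Definition upper_quantile (G : X -> R) (p : R) : with_ends X :=
  sup_in [set x | G x <= p].

Definition lower_quantile (G : X -> R) (p : R) : with_ends X :=
  sup_in [set x | G x < p].

Variables (dT : measure_display) (T : measurableType dT) (P : probability T R).

Definition cdf_of (Y : T -> X) (x : X) : R :=
  fine (P [set w | (Y w <= x)%O]).

(* Observations are indexed from 0: xi 0, xi 1, ... stand for X_1, X_2, ... *)
Definition empirical_cdf (xi : nat -> T -> X) (t : nat) (w : T) (x : X) : R :=
  t%:R^-1 * \sum_(i < t) ((xi i w <= x)%O : bool)%:R.

Definition iid (xi : nat -> T -> X) : Prop :=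
  [/\ forall i (B : set X), order_measurable B -> measurable (xi i @^-1` B),
      forall i (B : set X), order_measurable B ->
        P (xi i @^-1` B) = P (xi 0%N @^-1` B)
    & forall (J : seq nat) (B : nat -> set X), uniq J ->
        (forall i, order_measurable (B i)) ->
        P (\bigcap_(i in [set` J]) (xi i @^-1` B i)) =
        (\prod_(i <- J) P (xi i @^-1` B i))%E].

(* The law of Y is continuous along arbitrary monotone families of initial
   segments: for an infimum x of A that is not attained this is the right
   continuity of the distribution function F at x, for a supremum x of A that
   is not attained it is P(Y < x) = F(x-), and for A unbounded below or above
   it says that F tends to 0 or to 1.  By countable additivity it holds for
   every Y when all subsets of X have countable coinitial and cofinal subsets
   (X = R, X countable, X order-separable).  It can only fail for orders with
   uncountable cofinalities or coinitialities: for the 0-1 law on omega_1 that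
   gives mass 1 to the co-countable sets, F is identically 0 while every
   empirical distribution function is eventually 1. *)
Definition cdf_continuous (Y : T -> X) : Prop :=
  forall A : set X, A !=set0 ->
    P (\bigcup_(a in A) [set w | (Y w <= a)%O]) =
      ereal_sup [set P [set w | (Y w <= a)%O] | a in A] /\
    P (\bigcap_(a in A) [set w | (Y w <= a)%O]) =
      ereal_inf [set P [set w | (Y w <= a)%O] | a in A].

End Quantiles.

(* m may be any real number >= 1. *)
Definition radius (R : realType) (m C : R) (t : nat) : R :=
  85 / 100 * Num.sqrt (t%:R^-1 * (ln (ln (expR 1 * t%:R / m)) + C)).

(* Main.v *)
Require Import Defs.
From mathcomp Require Import ring lra.
Import Order.TTheory GRing.Theory Num.Theory.
Import numFieldNormedType.Exports.
Local Open Scope classical_set_scope.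
Local Open Scope ring_scope.

(** A quantile crosses its confidence band at time t exactly when some initial
    or final segment of the order catches too many of the first t observations.
    On the upper side the event is that, for some j between 1 and t, at least j
    observations lie in an initial segment of probability at most j/t - g_t; on
    the lower side the same holds for a final segment ([upper_quantile_hits],
    [lower_quantile_hits]).  Since j takes finitely many values, each side is
    at each time a finite union of counting events: this gives measurability
    and replaces the supremum over all p by a maximum over a finite chain of
    sets.  The bound on the probability of a segment comes from the continuity
    of the distribution function along families of initial segments.

    The times t >= m are cut into epochs u <= t < q u, with u = m q^k and
    q = 50/49.  In one epoch only finitely many segments, which form a chain,
    matter, so the observations can be replaced by i.i.d. draws from the finite
    set of cells that the segments cut out ([prob_cells]).  Write dev D for the
    number of draws in D minus its expectation.  If dev D >= level at some time
    of the epoch then, with probability at least 1/2, dev D still exceeds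
    level - d at the end of the epoch, where d^2 is a quarter of the largest
    possible number of remaining draws (Cantelli's inequality); an Ottaviani
    argument thus costs a factor 2 ([prob_block]).

    At a fixed time n the maximum over a chain D_1, D_2, ... is controlled by
    likelihood ratios.  Multiply the weights of all cells in D by a constant c
    and rescale the other cells: as D runs through the chain, the likelihood
    ratio of the sample coarsened to D is a nonnegative martingale of mean 1,
    so the probability that it ever reaches a is at most 1/a ([prob_lik]).
    With c = (1 + e)/(1 - e), a deviation dev D > n e on a set of mass at most
    (1 - e)/2 forces the ratio above exp (2 n e^2) ([upper_rate]).  A set of
    larger mass is replaced by its complement, which has mass at most
    (1 + e)/2 and a deviation below - n e; here c = (1 - e)/(1 + e) forces the
    ratio above exp ((11/6) n e^2) ([lower_rate]).  Hence the one-sided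
    Dvoretzky-Kiefer-Wolfowitz type bound of [prob_chain], whose sum of two
    exponentials replaces Massart's sharp constant.

    In epoch k one has n e = 0.85 sqrt (u C_k) - sqrt u / 14 and n <= q u,
    where C_k = C + log (1 + k/50) is a lower bound for log log (e t / m) + C.
    The exponents are then at least affine functions of C_k of slopes 1.371
    and 1.256, so the bounds sum over k like (1 + k/50)^(-1.371) and
    (1 + k/50)^(-1.256).  Both slopes exceed 1.25, hence C = 7 is the worst
    case, and there the total is about 1400 exp (- 1.25 C). *)

(** * Finite i.i.d. samples *)

Section Expect.
Variables (R : realFieldType) (I : finType) (p : I -> R).
Hypotheses (p_ge0 : forall x, 0 <= p x) (p_sum : \sum_x p x = 1).

(** The expectation of [f] over [n] independent draws with weights [p], one draw
    at a time: conditioning on a prefix is then computation, and the proofs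
    about stopping times below become inductions on the number of draws left. *)
Fixpoint expect (n : nat) (f : seq I -> R) : R :=
  if n is n'.+1 then \sum_x p x * expect n' (fun s => f (x :: s)) else f [::].

Definition prob (n : nat) (b : pred (seq I)) : R := expect n (fun s => (b s)%:R).

Lemma eq_expect n f g :
  (forall s, size s = n -> f s = g s) -> expect n f = expect n g.
Proof.
elim: n f g => [|n IHn] f g fg /=; first exact: fg.
apply: eq_bigr => x _; congr (_ * _); apply: IHn => s sn.
by apply: fg => /=; rewrite sn.
Qed.

Lemma le_expect n f g :
  (forall s, size s = n -> f s <= g s) -> expect n f <= expect n g.
Proof using p_ge0.
elim: n f g => [|n IHn] f g fg /=; first exact: fg.
apply: ler_sum => x _; apply: ler_wpM2l => //; apply: IHn => s sn.
by apply: fg => /=; rewrite sn.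
Qed.

Lemma expectD n f g :
  expect n (fun s => f s + g s) = expect n f + expect n g.
Proof.
elim: n f g => [|n IHn] f g //=.
rewrite -big_split /=; apply: eq_bigr => x _.
by rewrite -mulrDr -IHn.
Qed.

Lemma expectZ n a f : expect n (fun s => a * f s) = a * expect n f.
Proof.
elim: n f => [|n IHn] f //=.
by rewrite mulr_sumr; apply: eq_bigr => x _; rewrite mulrCA IHn.
Qed.

Lemma expect_cst n a : expect n (fun=> a) = a.
Proof using p_sum.
by elim: n => [|n IHn] //=; rewrite IHn -mulr_suml p_sum mul1r.
Qed.

Lemma le_prob n (a b : pred (seq I)) :
  (forall s, size s = n -> a s -> b s) -> prob n a <= prob n b.
Proof using p_ge0.
move=> ab; apply: le_expect => s sn; rewrite ler_nat.
by case: (a s) (ab s sn) => // ->.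
Qed.

Lemma prob_le1 n b : prob n b <= 1.
Proof using p_ge0 p_sum.
rewrite -[leRHS](expect_cst n 1).
by apply: le_expect => s _; rewrite lern1 leq_b1.
Qed.

Lemma probU n (a b : pred (seq I)) :
  prob n (fun s => a s || b s) <= prob n a + prob n b.
Proof using p_ge0.
rewrite -expectD; apply: le_expect => s _; rewrite -natrD ler_nat.
by case: (a s); case: (b s).
Qed.

(** Induction on the number of draws left: as long as [early] has not occurred
    the bound averages over the next draw, and when it occurs the hypothesis
    applies to the remaining draws, which are independent of the past. *)
Lemma ottaviani n (early late : pred (seq I)) (beta : R) :
    (forall s k, (size s + k)%N = n -> early s ->
       beta <= prob k (fun s' => late (s ++ s'))) ->
    0 <= beta ->
  beta * prob n (fun s => has (fun i => early (take i s)) (iota 0 n.+1))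
    <= prob n late.
Proof using p_ge0 p_sum.
move=> hbeta beta0.
suff H k s : (size s + k)%N = n ->
    beta * prob k (fun s' => has (fun i => early (take i (s ++ s')))
                                 (iota (size s) k.+1))
      <= prob k (fun s' => late (s ++ s')) by exact: (H n [::]).
elim: k s => [|k IHk] s sk.
  case: (boolP (early s)) => [es|nes].
    by apply: le_trans (hbeta _ _ sk es); rewrite ler_piMr ?prob_le1.
  by rewrite {1}/prob /= cats0 take_size (negbTE nes) /= mulr0 ler0n.
case: (boolP (early s)) => [es|nes].
  by apply: le_trans (hbeta _ _ sk es); rewrite ler_piMr ?prob_le1.
rewrite /prob /= mulr_sumr; apply: ler_sum => x _.
rewrite mulrCA; apply: ler_wpM2l => //.
have := IHk (rcons s x); rewrite size_rcons addSnnS => /(_ sk).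
rewrite /prob; set l := (X in X <= _ -> _); set r := (X in _ <= X -> _).
set l' := (X in _ -> X <= _); set r' := (X in _ -> _ <= X).
suff -> : l' = l by suff -> : r' = r by []; apply: eq_expect => t _;
  rewrite cat_rcons.
congr (_ * _); apply: eq_expect => t _.
by rewrite cat_rcons take_size_cat // (negbTE nes).
Qed.

Implicit Types (D E : {set I}) (s t : seq I).

Definition mass (D : {set I}) : R := \sum_(x in D) p x.

Definition dev (D : {set I}) (s : seq I) : R :=
  (count (mem D) s)%:R - (size s)%:R * mass D.

Lemma mass_ge0 D : 0 <= mass D.
Proof using p_ge0. by apply: sumr_ge0. Qed.

Lemma massC D : mass (~: D) = 1 - mass D.
Proof using p_sum.
rewrite -p_sum [in RHS](bigID (mem D)) /= addrAC subrr add0r.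
by apply: eq_bigl => x; rewrite inE.
Qed.

Lemma devC D s : dev (~: D) s = - dev D s.
Proof using p_sum.
have := count_predC (mem D) s; rewrite /dev massC.
have -> : count (mem (~: D)) s = count (predC (mem D)) s.
  by apply: eq_count => x; rewrite /= inE.
by move=> <-; rewrite natrD; ring.
Qed.

Lemma dev_cons D x s : dev D (x :: s) = dev D s + ((x \in D)%:R - mass D).
Proof. by rewrite /dev /= natrD -natr1; ring. Qed.

Lemma dev_cat D s t : dev D (s ++ t) = dev D s + dev D t.
Proof. by rewrite /dev count_cat size_cat !natrD; ring. Qed.

Lemma sum_mem D (a b : R) :
  \sum_x p x * (if x \in D then a else b) = mass D * a + (1 - mass D) * b.
Proof using p_sum.
rewrite (bigID (mem D)) /= -massC /mass !mulr_suml; congr (_ + _).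
  by apply: eq_bigr => x ->.
by apply: eq_big => x; rewrite ?inE // => /negbTE ->.
Qed.

Lemma expect_dev n D : expect n (dev D) = 0.
Proof using p_sum.
elim: n => [|n IHn] /=; first by rewrite /dev /= mul0r subrr.
under eq_bigr => x _ do
  rewrite (eq_expect (fun s _ => dev_cons D x s)) expectD IHn expect_cst add0r.
rewrite (eq_bigr (fun x => p x * (if x \in D then 1 - mass D else - mass D))).
  by rewrite sum_mem; ring.
by move=> x _; case: (x \in D); rewrite ?sub0r.
Qed.

Lemma expect_dev2 n D :
  expect n (fun s => dev D s ^+ 2) = n%:R * (mass D * (1 - mass D)).
Proof using p_sum.
elim: n => [|n IHn] /=; first by rewrite /dev /= mul0r subrr expr0n mul0r.
rewrite (eq_bigr (fun x => p x * (if x \in D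
   then n%:R * (mass D * (1 - mass D)) + (1 - mass D) ^+ 2
   else n%:R * (mass D * (1 - mass D)) + mass D ^+ 2))).
  by rewrite sum_mem -natr1; ring.
move=> x _; congr (_ * _).
rewrite (_ : expect n _ = expect n (fun s => dev D s ^+ 2
   + (2 * ((x \in D)%:R - mass D) * dev D s + ((x \in D)%:R - mass D) ^+ 2))).
  rewrite expectD expectD expectZ expect_dev expect_cst IHn mulr0 add0r.
  by case: (x \in D); rewrite ?sub0r ?sqrrN.
by apply: eq_expect => s _; rewrite dev_cons; ring.
Qed.

(** Cantelli's inequality: dev D has mean 0 and variance at most
    n / 4 <= d^2, and (z - d)^2 >= 4 d^2 for z <= - d, so that
    P(dev D <= - d) <= (n / 4 + d^2) / (4 d^2) <= 1/2. *)
Lemma prob_dev_gt n D (d : R) :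
    0 < d -> n%:R <= 4 * d ^+ 2 ->
  2^-1 <= prob n (fun s => - d < dev D s).
Proof using p_ge0 p_sum.
move=> d0 nd.
have var : expect n (fun s => dev D s ^+ 2) <= d ^+ 2.
  rewrite expect_dev2; have : mass D * (1 - mass D) <= 4^-1.
    have -> : mass D * (1 - mass D) = 4^-1 - (mass D - 2^-1) ^+ 2 by field.
    by rewrite gerBl sqr_ge0.
  have := ler0n R n; nra.
have d20 : 0 < 4 * d ^+ 2 by rewrite mulr_gt0 // exprn_gt0.
suff : 1 - prob n (fun s => - d < dev D s) <=
    (4 * d ^+ 2)^-1 * (d ^+ 2 + d ^+ 2).
  move=> h; suff -> : 2^-1 = 1 - (4 * d ^+ 2)^-1 * (d ^+ 2 + d ^+ 2) by lra.
  by field; rewrite gt_eqF.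
apply: (@le_trans _ _ ((4 * d ^+ 2)^-1
    * (expect n (fun s => dev D s ^+ 2) + d ^+ 2))); last first.
  by rewrite ler_wpM2l ?invr_ge0 ?(ltW d20) // lerD2r.
rewrite -[X in _ * (_ + X)](expect_cst n).
rewrite -[1 in leLHS](expect_cst n) -mulN1r -expectZ -expectD.
have -> : expect n (fun s => dev D s ^+ 2) =
          expect n (fun s => dev D s ^+ 2 + - (2 * d) * dev D s).
  by rewrite expectD expectZ expect_dev mulr0 addr0.
rewrite -expectD -expectZ; apply: le_expect => s _.
have -> : dev D s ^+ 2 + - (2 * d) * dev D s + d ^+ 2 = (dev D s - d) ^+ 2.
  by ring.
case: ltP => [_|dl]; first by
  rewrite mulN1r subrr mulr_ge0 ?sqr_ge0 // invr_ge0 ltW.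
rewrite mulr0 addr0 mulrC ler_pdivlMr // mul1r; nra.
Qed.

(** What an observer of [D] sees of a draw: its cell when that lies in [D], and
    otherwise only that it lies outside.  For growing [D] these are the
    sigma-fields of the martingale [lik]. *)
Definition keep (D : {set I}) (x : I) : option I :=
  if x \in D then Some x else None.

Definition seen_by (D : {set I}) (f : seq I -> R) : Prop :=
  forall s t, map (keep D) s = map (keep D) t -> f s = f t.

Lemma seen_by_cons D f x : seen_by D f -> seen_by D (fun s => f (x :: s)).
Proof. by move=> fD s t st; apply: fD; rewrite /= st. Qed.

Lemma seen_byS (D E : {set I}) f : D \subset E -> seen_by D f -> seen_by E f.
Proof.
move=> /fintype.subsetP DE fD s t st; apply: fD.
pose g o := if o is Some y then keep D y else None.
have gK u : map (keep D) u = map g (map (keep E) u).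
  rewrite -map_comp; apply: eq_map => x; rewrite /= /keep.
  case: (boolP (x \in E)) => //= xE.
  by rewrite ifF //; apply: contraNF xE; apply: DE.
by rewrite !gK st.
Qed.

Variable c : R.
Hypothesis c_gt0 : 0 < c.

(** The density relative to [p], as seen by an observer of [D], of a law that
    gives every set [E] inside [D] the mass [c * mass E]. *)
Definition tilt (D : {set I}) (x : I) : R :=
  if x \in D then c else (1 - c * mass D) / (1 - mass D).

Definition lik (D : {set I}) (s : seq I) : R := \prod_(x <- s) tilt D x.

Definition tiltable (D : {set I}) : Prop := mass D < 1 /\ c * mass D < 1.

Lemma tilt_gt0 D x : tiltable D -> 0 < tilt D x.
Proof using c_gt0.
move=> [D1 cD]; rewrite /tilt; case: ifP => // _.
by rewrite divr_gt0 ?subr_gt0.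
Qed.

Lemma lik_gt0 D s : tiltable D -> 0 < lik D s.
Proof using c_gt0.
by move=> tD; apply: prodr_gt0 => x _; apply: tilt_gt0.
Qed.

Lemma likE D s :
  lik D s = c ^+ count (mem D) s
    * ((1 - c * mass D) / (1 - mass D)) ^+ (size s - count (mem D) s).
Proof.
elim: s => [|x s IHs]; first by rewrite /lik big_nil mul1r.
rewrite /lik big_cons -/(lik D s) IHs /= /tilt; have := count_size (mem D) s.
case: (x \in D) => h /=; first by rewrite !add1n subSS exprS mulrA.
by rewrite !add0n subSn // mulrCA -exprS.
Qed.

Lemma sum_tiltC D E : tiltable E -> D \subset E ->
  \sum_(x | x \notin D) p x * tilt E x = 1 - c * mass D.
Proof using p_sum.
move=> [E1 _] /fintype.subsetP DE.
have : \sum_x p x * tilt E x = 1.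
  by rewrite sum_mem; field; rewrite subr_eq0 gt_eqF.
rewrite (bigID (mem D)) /= => <-.
have -> : \sum_(x in D) p x * tilt E x = c * mass D.
  by rewrite mulr_sumr; apply: eq_bigr => x xD; rewrite /tilt (DE _ xD) mulrC.
by ring.
Qed.

(** The martingale property along [D \subset E].  It holds draw by draw: the two
    densities agree on [D], and off [D], where [f] cannot distinguish the
    cells, both have total mass 1 - c * mass D. *)
Lemma expect_lik n f D E : tiltable D -> tiltable E -> D \subset E ->
  seen_by D f ->
  expect n (fun s => f s * lik E s) = expect n (fun s => f s * lik D s).
Proof using p_sum.
move=> tD tE DE; elim: n f => [|n IHn] f fD /=; first by rewrite /lik !big_nil.
pose G x := expect n (fun s => f (x :: s) * lik D s).
have step H : tiltable H ->
    \sum_x p x * expect n (fun s => f (x :: s) * lik H (x :: s))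
  = \sum_x p x * (tilt H x * expect n (fun s => f (x :: s) * lik H s)).
  move=> tH; apply: eq_bigr => x _; congr (_ * _); rewrite -expectZ.
  by apply: eq_expect => s _; rewrite /lik big_cons mulrCA.
rewrite !step //.
have -> : \sum_x p x * (tilt E x * expect n (fun s => f (x :: s) * lik E s))
   = \sum_x p x * (tilt E x * G x).
  by apply: eq_bigr => x _; rewrite IHn //; apply: seen_by_cons.
rewrite -/(G _) !(bigID (mem D) predT) /=; congr (_ + _).
  apply: eq_bigr => x xD; rewrite -/(G x) /tilt xD.
  by rewrite (fintype.subsetP DE).
have [y yD|nD] := pickP [pred x | x \notin D]; last by rewrite !big_pred0.
have GE x : x \notin D -> G x = G y.
  move=> xD; apply: eq_expect => s _; congr (_ * _); apply: fD => /=.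
  by rewrite /keep (negbTE xD) (negbTE yD).
have sumE H : tiltable H -> D \subset H ->
    \sum_(x | x \notin D) p x * (tilt H x * G x) = (1 - c * mass D) * G y.
  move=> tH DH; rewrite -(sum_tiltC tH DH) mulr_suml.
  by apply: eq_bigr => x xD; rewrite GE // mulrA.
by rewrite !sumE.
Qed.

(** Doob's maximal inequality.  The weight [f] records that no earlier set of the
    chain has reached the level [a]; it is split at the head [E] of the chain
    into the part where [lik E] reaches [a], which is charged at once, and the
    part where it does not, to which the induction applies. *)
Lemma maximal_lik n a f D Ds : 0 <= a -> (forall s, 0 <= f s) ->
    seen_by D f -> tiltable D -> (forall E, E \in Ds -> tiltable E) ->
    path (fun A B : {set I} => A \subset B) D Ds ->
  a * expect n (fun s => f s * (has (fun E => a <= lik E s) Ds)%:R)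
    <= expect n (fun s => f s * lik D s).
Proof using p_ge0 p_sum c_gt0.
move=> a0; elim: Ds D f => [|E Ds IH] D f f0 fD tD tDs /=.
  move=> _; rewrite -expectZ; apply: le_expect => s _.
  by rewrite !mulr0 mulr_ge0 // ltW // lik_gt0.
move=> /andP[DE EDs].
have tE : tiltable E by apply: tDs; rewrite mem_head.
rewrite -(expect_lik n tD tE DE fD).
pose b s := a <= lik E s.
have bE : seen_by E (fun s => (~~ b s)%:R).
  have likK s : lik E s = \prod_(y <- map (keep E) s)
      (if y is Some _ then c else (1 - c * mass E) / (1 - mass E)).
    by rewrite big_map; apply: eq_bigr => x _; rewrite /tilt /keep; case: ifP.
  by move=> s t st; rewrite /b !likK st.
have := IH E (fun s => f s * (~~ b s)%:R) _ _ tE _ EDs.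
move=> /(_ (fun s => mulr_ge0 (f0 s) (ler0n _ _))) h.
apply: (@le_trans _ _
  (expect n (fun s => f s * (b s)%:R * lik E s)
    + expect n (fun s => f s * (~~ b s)%:R * lik E s))); last first.
  rewrite -expectD; apply: le_expect => s _.
  by case: (b s); rewrite /= ?mulr1 ?mulr0 ?mul0r ?add0r ?addr0.
apply: le_trans (lerD (lexx _) (h _ _)); last first.
- by move=> F FDs; apply: tDs; rewrite inE FDs orbT.
- move=> s t st; congr (_ * _); last exact: bE.
  exact: (seen_byS DE fD).
rewrite -expectZ -[X in _ + X]expectZ -expectD; apply: le_expect => s _.
rewrite -/(b s) /b; case: (leP a (lik E s)) => [al|_] /=.
  rewrite !mulr1 mulr0 mul0r mulr0 addr0 mulrC; exact: ler_wpM2l.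
by rewrite mulr0 mul0r add0r mulr1.
Qed.

Lemma prob_lik n a Ds : 0 < a -> (forall E, E \in Ds -> tiltable E) ->
    sorted (fun A B : {set I} => A \subset B) Ds ->
  prob n (fun s => has (fun E => a <= lik E s) Ds) <= a^-1.
Proof using p_ge0 p_sum c_gt0.
move=> a0 tDs sDs.
pose O : {set I} := finset.set0.
have m0 : mass O = 0 by rewrite /mass big_set0.
have tO : tiltable O by split; rewrite m0 ?mulr0 ltr01.
have pO : path (fun A B : {set I} => A \subset B) O Ds.
  by case: Ds sDs {tDs} => //= E Ds ->; rewrite finset.sub0set.
have sO : seen_by O (fun=> 1) by [].
have := maximal_lik n (ltW a0) (fun=> ler01) sO tO tDs pO.
have -> : expect n (fun s => 1 * lik O s) = 1.
  rewrite -[RHS](expect_cst n); apply: eq_expect => s _; rewrite mul1r /lik.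
  by apply: big1 => x _; rewrite /tilt finset.in_set0 m0 mulr0 !subr0 divr1.
have -> : expect n (fun s => 1 * (has (fun E => a <= lik E s) Ds)%:R) =
  prob n (fun s => has (fun E => a <= lik E s) Ds).
  by apply: eq_expect => s _; rewrite mul1r.
by rewrite mulrC -ler_pdivlMr // mul1r.
Qed.

End Expect.

(** * The log-odds function *)

Section LogOdds.
Variable R : realType.
Implicit Types e f x y : R.

Lemma mean_value (g dg : R -> R) (a b : R) : a <= b ->
    (forall x, a <= x <= b -> is_derive x 1 g (dg x)) ->
  exists2 c, a <= c <= b & g b - g a = dg c * (b - a).
Proof.
move=> ab dgP.
have [c||c cab ->] := @MVT_segment R g dg a b ab.
- by rewrite in_itv /= => /andP[ac cb]; apply: dgP; rewrite !ltW.
- apply: derivable_within_continuous => x; rewrite in_itv /= => xab.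
  by have [] := dgP x xab.
by exists c; rewrite // in_itv in cab.
Qed.

(** Twice the inverse hyperbolic tangent.  The likelihood ratios below involve
    constants of the form (1 + x) / (1 - x), whose logarithms these are. *)
Definition logodds x : R := ln (1 + x) - ln (1 - x).

Lemma is_derive_logodds x : -1 < x < 1 ->
  is_derive x 1 logodds (2 / (1 - x ^+ 2)).
Proof.
move=> /andP[x1 x2]; rewrite /logodds.
have p1 : 0 < 1 + x by lra.
have p2 : 0 < 1 - x by lra.
have d1 := is_derive1_ln p1.
have d2 := is_derive1_ln p2.
apply: is_derive_eq; field; rewrite -[0%R]/(0 : R) ?gt_eqF //; nra.
Qed.

Lemma logodds_slope x y : 0 <= x <= y -> y < 1 ->
  2 / (1 - x ^+ 2) * (y - x) <= logodds y - logodds x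
    <= 2 / (1 - y ^+ 2) * (y - x).
Proof.
move=> /andP[x0 xy] y1.
have [z|z /andP[xz zy] ->] :=
    @mean_value logodds (fun z => 2 / (1 - z ^+ 2)) _ _ xy.
  by move=> /andP[xz zy]; apply: is_derive_logodds; lra.
have [z0 z1] : 0 <= z /\ z < 1 by lra.
apply/andP; split; (apply: ler_wpM2r; first by rewrite subr_ge0);
  rewrite ler_pM2l ?ltr0n // lef_pV2 ?posrE; nra.
Qed.

Lemma logodds0 : logodds 0 = 0.
Proof. by rewrite /logodds addr0 subr0 subrr. Qed.

Lemma logodds_ge x : 0 <= x < 1 -> 2 * x <= logodds x.
Proof.
move=> /andP[x0 x1]; have := @logodds_slope 0 x _ x1.
rewrite lexx x0 => /(_ isT)/andP[+ _].
by rewrite expr0n !subr0 divr1 logodds0 subr0.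
Qed.

(** [logodds] is convex on [0, 1[ and vanishes at 0, hence its chord slopes from
    the origin increase. *)
Lemma logodds_star f e : 0 <= f <= e -> e < 1 ->
  e * logodds f <= f * logodds e.
Proof.
move=> /andP[f0 fe] e1.
have := @logodds_slope f e _ e1; rewrite f0 fe => /(_ isT)/andP[+ _].
have := @logodds_slope 0 f _ (le_lt_trans fe e1).
rewrite lexx f0 logodds0 !subr0 => /(_ isT)/andP[_ +].
set D := 2 / _; set F := logodds f; set E := logodds e => h2 h1.
have h : (e - f) * F <= f * (E - F).
  apply: (@le_trans _ _ ((e - f) * (D * f))).
    by rewrite ler_wpM2l // subr_ge0.
  by rewrite mulrA mulrC [(e - f) * D]mulrC ler_wpM2l.
lra.
Qed.

(** Integrate the derivative 2 / (1 - y^2) = 2 + 2 y^2 / (1 - y^2) from 0 to x,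
    with the denominator of the last term replaced by 1 - x^2. *)
Lemma logodds_le x : 0 <= x < 1 ->
  logodds x <= 2 * x + 2 * x ^+ 3 / (3 * (1 - x ^+ 2)).
Proof.
move=> /andP[x0 x1].
pose g y := 2 * y + 2 / 3 * (y ^+ 3 * (1 - y ^+ 2)^-1) - logodds y.
pose dg y := 4 / 3 * y ^+ 4 / (1 - y ^+ 2) ^+ 2.
have dgP y : 0 <= y <= x -> is_derive y 1 g (dg y).
  move=> /andP[y0 yx].
  have ny : 1 - y ^+ 2 != 0 by rewrite gt_eqF //; nra.
  have d1 : is_derive y 1 logodds (2 / (1 - y ^+ 2)).
    by apply: is_derive_logodds; lra.
  have d2 : is_derive y 1 (fun y => (1 - y ^+ 2)^-1)
      (- (1 - y ^+ 2) ^- 2 *: (0 - (2 * y))).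
    apply: is_deriveV => //; apply: is_derive_eq.
    by rewrite /GRing.scale /=; ring.
  rewrite /g; apply: is_derive_eq.
  by rewrite /dg /GRing.scale /=; field.
have [c /andP[c0 cx] h] := mean_value x0 dgP.
have : 0 <= g x - g 0.
  rewrite h subr0 mulr_ge0 // /dg !mulr_ge0 ?exprn_ge0 ?invr_ge0 ?sqr_ge0 //.
rewrite /g logodds0 !mulr0 !expr0n /= mul0r mulr0 addr0 subrr subr0 subr_ge0.
suff -> : 2 * x ^+ 3 / (3 * (1 - x ^+ 2)) =
  2 / 3 * (x ^+ 3 * (1 - x ^+ 2)^-1) by [].
by field; rewrite gt_eqF //; nra.
Qed.

End LogOdds.

(** * Exponential bounds for the maximal deviation over a chain *)

Section ChainDeviation.
Variable R : realType.

(** For the mass s, the right-hand side is 1/n times the logarithm of the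
    likelihood ratio, with c = (1 + e) / (1 - e), of a sample of size n with
    exactly n (s + e) draws in the set.  Off the set the density is
    (1 - f) / (1 + f) with f = e s / (1 - e - s) <= e, so that the rate is
    (s + e) T(e) - (1 - s - e) T(f) for T = [logodds]; star-shapedness of T
    gives (1 - s - e) T(f) <= s T(e) and leaves e T(e) >= 2 e^2. *)
Lemma upper_rate (e s : R) : 0 < e < 1 -> 0 <= s <= (1 - e) / 2 ->
  2 * e ^+ 2 <= (s + e) * ln ((1 + e) / (1 - e))
    + (1 - s - e) * ln ((1 - (1 + e) / (1 - e) * s) / (1 - s)).
Proof.
move=> /andP[e0 e1] /andP[s0 s1].
have g : 0 < 1 - e - s by lra.
pose f := e * s / (1 - e - s).
have f0 : 0 <= f by rewrite divr_ge0 ?mulr_ge0 // ltW.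
have fe : f <= e by rewrite ler_pdivrMr //; nra.
have -> : (1 - (1 + e) / (1 - e) * s) / (1 - s) = (1 - f) / (1 + f).
  by rewrite /f; field; rewrite ?gt_eqF //; nra.
rewrite !ln_div ?posrE; try lra.
have := @logodds_star R f e; rewrite f0 fe => /(_ isT e1).
have := @logodds_ge R e; rewrite (ltW e0) e1 => /(_ isT).
rewrite -[ln (1 - f) - _]opprB -!/(logodds _).
have {2}-> : f = e * s / (1 - e - s) by [].
set F := logodds f; set E := logodds e => hE.
rewrite mulrAC ler_pdivlMr // => hF.
have : (1 - s - e) * F <= s * E by rewrite -(ler_pM2l e0); nra.
by nra.
Qed.

(** The mirror image, with n (s - e) draws in the set and the density
    (1 + f) / (1 - f) off it, f = e s / (1 + e - s): the rate is
    (1 - s + e) T(f) - (s - e) T(e).  Now T(e) enters with the wrong sign, and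
    the cubic upper bound on it costs at most e^2 / 6, because s - e does not
    exceed (1 - e) / 2. *)
Lemma lower_rate (e s : R) : 0 < e < 1 -> e <= s <= (1 + e) / 2 ->
  11 / 6 * e ^+ 2 <= (s - e) * ln ((1 - e) / (1 + e))
    + (1 - s + e) * ln ((1 - (1 - e) / (1 + e) * s) / (1 - s)).
Proof.
move=> /andP[e0 e1] /andP[s0 s1].
have g : 0 < 1 + e - s by lra.
pose f := e * s / (1 + e - s).
have f0 : 0 <= f by rewrite divr_ge0 ?mulr_ge0 // ltW; lra.
have fe : f <= e by rewrite ler_pdivrMr //; nra.
have -> : (1 - (1 - e) / (1 + e) * s) / (1 - s) = (1 + f) / (1 - f).
  by rewrite /f; field; rewrite ?gt_eqF //; nra.
rewrite !ln_div ?posrE; try lra.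
have := @logodds_ge R f; rewrite f0 (le_lt_trans fe e1) => /(_ isT).
have := @logodds_le R e; rewrite (ltW e0) e1 => /(_ isT).
rewrite -[ln (1 - e) - _]opprB -!/(logodds _).
set F := logodds f; set E := logodds e => hE hF.
have hF' : 2 * (e * s) <= (1 - s + e) * F.
  have -> : e * s = (1 + e - s) * f by rewrite /f; field; rewrite gt_eqF.
  by nra.
have hr : (s - e) * (2 * e ^+ 3 / (3 * (1 - e ^+ 2))) <= e ^+ 2 / 6.
  rewrite mulrA ler_pdivrMr; last by nra.
  have -> : e ^+ 2 / 6 * (3 * (1 - e ^+ 2)) = e ^+ 2 * ((1 - e) * (1 + e)) / 2.
    by field.
  have -> : (s - e) * (2 * e ^+ 3) = e ^+ 2 * ((s - e) * 2 * e) by ring.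
  by rewrite -[leRHS]mulrA ler_wpM2l ?sqr_ge0 //; nra.
have : (s - e) * E <= (s - e) * (2 * e) + e ^+ 2 / 6.
  apply: le_trans (lerD (lexx _) hr); rewrite -mulrDr.
  by rewrite ler_wpM2l // subr_ge0.
by nra.
Qed.

Lemma expR_mixed_power (c u : R) (k n : nat) : 0 < c -> 0 < u -> (k <= n)%N ->
  c ^+ k * u ^+ (n - k) = expR (k%:R * ln c + (n%:R - k%:R) * ln u).
Proof.
move=> c0 u0 kn; rewrite expRD -natrB //.
by rewrite !expRM_natl !lnK ?posrE.
Qed.

Variables (I : finType) (p : I -> R).
Hypotheses (p_ge0 : forall x, 0 <= p x) (p_sum : \sum_x p x = 1).
Implicit Types (D : {set I}) (Ds : seq {set I}).

Lemma prob_upper_chain n (e : R) Ds : 0 < e < 1 ->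
    (forall D, D \in Ds -> mass p D <= (1 - e) / 2) ->
    sorted (fun A B : {set I} => A \subset B) Ds ->
  prob p n (fun s => has (fun D => n%:R * e < dev p D s) Ds)
    <= expR (- (2 * n%:R * e ^+ 2)).
Proof using p_ge0 p_sum.
move=> e01 smallDs sDs; case/andP: (e01) => e0 e1.
pose c := (1 + e) / (1 - e).
have c0 : 0 < c by rewrite divr_gt0; lra.
have ce : c * (1 - e) = 1 + e by rewrite /c mulfVK // gt_eqF //; lra.
have tDs D : D \in Ds -> tiltable p c D.
  by move=> /smallDs h; have := mass_ge0 p_ge0 D; split; [lra|nra].
rewrite expRN; apply: le_trans (prob_lik p_ge0 p_sum c0 n (expR_gt0 _) tDs sDs).
apply: le_prob => // s sn /hasP[D DDs]; rewrite {1}/dev sn => devD.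
apply/hasP; exists D => //; have [D1 cD] := tDs D DDs.
have D0 := mass_ge0 p_ge0 D; have Ds' := smallDs D DDs.
have ce1 : 1 <= c by nra.
have u0 : 0 < (1 - c * mass p D) / (1 - mass p D) by rewrite divr_gt0 ?subr_gt0.
rewrite likE expR_mixed_power ?count_size // sn ler_expR.
have := @upper_rate e (mass p D) e01; rewrite D0 Ds' => /(_ isT).
rewrite -/c; set u := (1 - _) / _ => /(ler_wpM2l (ler0n R n)) rate.
have lc : 0 <= ln c by apply: ln_ge0.
have lu : ln u <= 0.
  by apply: ln_le0; rewrite /u ler_pdivrMr ?subr_gt0 // mul1r lerB // ler_peMl.
have : 0 <= ((count (mem D) s)%:R - n%:R * (mass p D + e)) * (ln c - ln u).
  by rewrite mulr_ge0 //; lra.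
lra.
Qed.

Lemma prob_lower_chain n (e : R) Ds : 0 < e < 1 ->
    (forall D, D \in Ds -> mass p D <= (1 + e) / 2) ->
    sorted (fun A B : {set I} => A \subset B) Ds ->
  prob p n (fun s => has (fun D => dev p D s < - (n%:R * e)) Ds)
    <= expR (- (11 / 6 * n%:R * e ^+ 2)).
Proof using p_ge0 p_sum.
move=> e01 smallDs sDs; case/andP: (e01) => e0 e1.
pose c := (1 - e) / (1 + e).
have c0 : 0 < c by rewrite divr_gt0; lra.
have ce : c * (1 + e) = 1 - e by rewrite /c mulfVK // gt_eqF //; lra.
have ce1 : c <= 1 by nra.
have tDs D : D \in Ds -> tiltable p c D.
  by move=> /smallDs h; have := mass_ge0 p_ge0 D; split; [lra|nra].
rewrite expRN; apply: le_trans (prob_lik p_ge0 p_sum c0 n (expR_gt0 _) tDs sDs).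
apply: le_prob => // s sn /hasP[D DDs]; rewrite {1}/dev sn => devD.
apply/hasP; exists D => //; have [D1 cD] := tDs D DDs.
have D0 := mass_ge0 p_ge0 D; have Ds' := smallDs D DDs.
(* The count is nonnegative, so such a deviation needs mass at least e. *)
have De : e <= mass p D.
  have k0 := ler0n R (count (mem D) s).
  have n0 : 0 < n%:R :> R.
    by rewrite ltr0n lt0n; apply: contraTneq devD => ->; rewrite -leNgt; lra.
  by rewrite -(ler_pM2l n0); lra.
have u0 : 0 < (1 - c * mass p D) / (1 - mass p D) by rewrite divr_gt0 ?subr_gt0.
rewrite likE expR_mixed_power ?count_size // sn ler_expR.
have := @lower_rate e (mass p D) e01; rewrite De Ds' => /(_ isT).
rewrite -/c; set u := (1 - _) / _ => /(ler_wpM2l (ler0n R n)) rate.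
have lc : ln c <= 0 by apply: ln_le0.
have lu : 0 <= ln u.
  by apply: ln_ge0; rewrite /u ler_pdivlMr ?subr_gt0 // mul1r lerB // ler_piMl.
have : 0 <= (n%:R * (mass p D - e) - (count (mem D) s)%:R) * (ln u - ln c).
  by rewrite mulr_ge0 //; lra.
lra.
Qed.

Definition chain Ds : Prop :=
  {in Ds &, forall A B : {set I}, (A \subset B) || (B \subset A)}.

Lemma chain_sorted (Ds : seq {set I}) (P : pred {set I}) : chain Ds ->
  sorted (fun A B : {set I} => A \subset B)
    (seq.filter P (sort (fun A B : {set I} => A \subset B) Ds)).
Proof.
move=> cDs; apply: sorted_filter.
  by move=> B A C; apply: fintype.subset_trans.
by apply: (@sort_sorted_in _ (mem Ds)) => //; apply/allP.
Qed.

(** A deviation n e >= n is impossible.  Otherwise the sets of mass at most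
    (1 - e) / 2 are treated directly and the others through their complements,
    which again form a chain. *)
Lemma prob_chain n (e : R) Ds : 0 < e -> chain Ds ->
  prob p n (fun s => has (fun D => n%:R * e < dev p D s) Ds)
    <= expR (- (2 * n%:R * e ^+ 2)) + expR (- (11 / 6 * n%:R * e ^+ 2)).
Proof using p_ge0 p_sum.
move=> e0 cDs; have [e1|e1] := leP 1 e.
  rewrite (@le_trans _ _ 0) ?addr_ge0 ?expR_ge0 // -[leRHS](expect_cst p_sum n).
  apply: le_expect => // s sn; rewrite lern0 eqb0.
  apply/hasPn => D _; rewrite -leNgt /dev sn.
  have : (count (mem D) s)%:R <= n%:R :> R by rewrite ler_nat -sn count_size.
  have := mulr_ge0 (ler0n R n) (mass_ge0 p_ge0 D).
  have := ler_wpM2l (ler0n R n) e1; lra.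
have e01 : 0 < e < 1 by rewrite e0.
pose srt := sort (fun A B : {set I} => A \subset B).
pose low := seq.filter (fun D => mass p D <= (1 - e) / 2) (srt Ds).
pose high := seq.filter (fun D => mass p D <= (1 + e) / 2)
  (srt (map (@finset.setC I) Ds)).
have cDsC : chain (map (@finset.setC I) Ds).
  move=> _ _ /mapP[A ADs ->] /mapP[B BDs ->].
  by rewrite !finset.setCS orbC; apply: cDs.
have slow : sorted (fun A B : {set I} => A \subset B) low by apply: chain_sorted.
have shigh : sorted (fun A B : {set I} => A \subset B) high.
  exact: chain_sorted.
apply: le_trans (lerD (prob_upper_chain n e01 _ slow)
                      (prob_lower_chain n e01 _ shigh)).
- apply: le_trans (probU _ _ _ _) => //.
  apply: le_prob => // s sn /hasP[D DDs devD].
  have [mD|mD] := leP (mass p D) ((1 - e) / 2); apply/orP; [left|right].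
    by apply/hasP; exists D => //; rewrite mem_filter mD mem_sort.
  apply/hasP; exists (finset.setC D); last by rewrite devC // ltrN2.
  rewrite mem_filter mem_sort map_f // andbT massC //; lra.
- by move=> D; rewrite mem_filter => /andP[].
- by move=> D; rewrite mem_filter => /andP[].
Qed.

End ChainDeviation.

(** * Maximal deviation over a chain and an epoch *)

Section Block.
Variables (R : realType) (I : finType) (p : I -> R).
Hypotheses (p_ge0 : forall x, 0 <= p x) (p_sum : \sum_x p x = 1).

(** Once the deviation is at least [A], with at most 4 d^2 draws to come, it stays
    above [A - d] with probability at least 1/2, whence the factor 2. *)
Lemma prob_block n (A d : R) (Ds : seq {set I}) : (0 < n)%N -> 0 < d < A ->
    chain Ds ->
  prob p n (fun s => has (fun t => (n%:R - t%:R <= 4 * d ^+ 2) &&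
      has (fun D => A <= dev p D (take t s)) Ds) (iota 0 n.+1))
    <= 2 * (expR (- (2 * (A - d) ^+ 2 / n%:R))
            + expR (- (11 / 6 * (A - d) ^+ 2 / n%:R))).
Proof using p_ge0 p_sum.
move=> n0 /andP[d0 dA] cDs.
have n0' : 0 < n%:R :> R by rewrite ltr0n.
pose early s := (n%:R - (size s)%:R <= 4 * d ^+ 2) &&
  has (fun D => A <= dev p D s) Ds.
pose late s := has (fun D => n%:R * ((A - d) / n%:R) < dev p D s) Ds.
have half s k : (size s + k)%N = n -> early s ->
    2^-1 <= prob p k (fun s' => late (s ++ s')).
  move=> sk /andP[nk /hasP[D DDs AD]].
  apply: le_trans (@prob_dev_gt _ _ p p_ge0 p_sum k D d d0 _) _.
    by move: nk; rewrite -sk natrD addrAC subrr add0r.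
  apply: le_prob => // s' _ ds'; apply/hasP; exists D => //.
  by rewrite mulrCA mulfV ?gt_eqF // mulr1 dev_cat; lra.
have ge0 : 0 <= 2^-1 :> R by rewrite invr_ge0.
have := ottaviani p_ge0 p_sum half ge0.
rewrite -ler_pdivlMl ?invr_gt0 // invrK => h.
apply: le_trans (le_trans h _).
  apply: le_prob => // s sn /hasP[t tn /andP[nt Ads]]; apply/hasP; exists t => //.
  move: tn; rewrite mem_iota add0n ltnS => /= tn.
  by rewrite /early size_takel ?sn // nt.
rewrite ler_pM2l //; apply: le_trans (prob_chain p_ge0 p_sum n _ cDs) _.
  by rewrite divr_gt0 // subr_gt0.
have E a : a * n%:R * ((A - d) / n%:R) ^+ 2 = a * (A - d) ^+ 2 / n%:R.
  by field; rewrite gt_eqF.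
by rewrite !E.
Qed.

End Block.

(** * From the order to finitely many cells *)

Section OrderMeasurable.
Variables (d : Order.disp_t) (X : orderType d).
Implicit Types A B : set X.

Lemma order_measurable0 : order_measurable (set0 : set X).
Proof. exact: sigma_algebra0. Qed.

Lemma order_measurableC A : order_measurable A -> order_measurable (~` A).
Proof. by move=> mA; rewrite -setTD; apply: sigma_algebraCD. Qed.

Lemma order_measurableT : order_measurable (setT : set X).
Proof. by rewrite -setC0; apply: order_measurableC; apply: order_measurable0. Qed.

Lemma order_measurableI A B :
  order_measurable A -> order_measurable B -> order_measurable (A `&` B).
Proof.
move=> mA mB; rewrite -[A `&` B]setCK setCI -bigcup2E.
apply: order_measurableC; apply: sigma_algebra_bigcup => -[|[|i]];
  rewrite /bigcup2 /=; [exact: order_measurableC..|exact: order_measurable0].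
Qed.

Lemma order_measurable_bigcap (I : finType) (F : I -> set X) :
  (forall i, order_measurable (F i)) ->
  order_measurable (\bigcap_i F i).
Proof.
move=> mF.
have <- : [set` index_enum I] = setT.
  by apply/seteqP; split=> i //= _; rewrite mem_index_enum.
rewrite bigcap_seq; apply: big_ind => //.
  exact: order_measurableT.
exact: order_measurableI.
Qed.

Definition down_closed A : Prop := forall x y, (x <= y)%O -> A y -> A x.

Hypothesis complete : complete_order X.

(** By completeness an initial segment is empty, everything, or an open or closed
    ray that ends at its supremum. *)
Lemma down_closed_measurable A : down_closed A -> order_measurable A.
Proof using complete.
move=> dA.
have [->|/set0P A0] := eqVneq A set0; first exact: order_measurable0.
have [[z zA]|nA] := pselect (exists z, ~ A z); last first.
  rewrite (_ : A = setT); first exact: order_measurableT.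
  by apply/seteqP; split => // x _; apply: contrapT => xA; apply: nA; exists x.
have ub_z : ubound A z.
  move=> y Ay; rewrite leNgt; apply/negP => zy; apply: zA.
  exact: dA (ltW zy) Ay.
have [b [ubA lubA]] : supremums A !=set0 by apply: complete => //; exists z.
apply: sub_sigma_algebra; exists b.
have [Ab|nAb] := pselect (A b); [left|right]; apply/seteqP; split => x /=.
- exact: ubA.
- by move=> xb; exact: dA xb Ab.
- move=> Ax; rewrite lt_neqAle ubA // andbT.
  by apply: contra_notN nAb => /eqP <-.
- rewrite ltNge => xb; apply: contrapT => nAx; move/negP: xb; apply.
  apply: lubA => y Ay; rewrite leNgt; apply/negP => xy; apply: nAx.
  exact: dA (ltW xy) Ay.
Qed.

End OrderMeasurable.

Section Cells.
Variables (R : realType) (dT : measure_display) (T : measurableType dT).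
Variables (P : probability T R) (d : Order.disp_t) (X : orderType d).
Variables (xi : nat -> T -> X) (hiid : iid P xi).
Variables (A : finType) (E : A -> set X).
Hypothesis mE : forall a, order_measurable (E a).

Definition cell (x : X) : {ffun A -> bool} := [ffun a => `[< E a x >]].

Definition weight (c : {ffun A -> bool}) : R :=
  fine (P (xi 0%N @^-1` (cell @^-1` [set c]))).

Definition cells_of (n : nat) (w : T) : seq {ffun A -> bool} :=
  mkseq (fun i => cell (xi i w)) n.

Lemma cell_measurable c : order_measurable (cell @^-1` [set c]).
Proof using mE.
rewrite (_ : _ @^-1` _ = \bigcap_a (if c a then E a else ~` E a)).
  apply: order_measurable_bigcap => a.
  by case: (c a) => //; apply: order_measurableC.
apply/seteqP; split => x /=.
  by move=> <- a _; rewrite ffunE; case: asboolP.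
move=> h; apply/ffunP => a; have := h a I; rewrite ffunE.
by case: (c a) => Ex; apply/asboolP.
Qed.

Lemma weight_fin c :
  P (xi 0%N @^-1` (cell @^-1` [set c])) = (weight c)%:E.
Proof using mE hiid.
rewrite /weight fineK //; apply: fin_num_measure.
by case: hiid => m _ _; apply: m; apply: cell_measurable.
Qed.

Lemma weight_ge0 c : 0 <= weight c.
Proof. by rewrite fine_ge0. Qed.

Lemma prob_prefix pre :
  let S := [set w | cells_of (size pre) w = pre] in
  measurable S /\ P S = (\prod_(c <- pre) weight c)%:E.
Proof using mE hiid.
move=> S; have [mX same indep] := hiid.
pose c0 : {ffun A -> bool} := [ffun=> false].
pose B i : set X := cell @^-1` [set nth c0 pre i].
have mB i : order_measurable (B i) by apply: cell_measurable.
have SE : S = \bigcap_(i in [set` iota 0 (size pre)]) (xi i @^-1` B i).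
  apply/seteqP; split => w /=.
    move=> Sw i; rewrite /= mem_iota add0n => /= ip.
    by rewrite /B /= -Sw nth_mkseq.
  move=> h; apply: (@eq_from_nth _ c0); first by rewrite size_mkseq.
  move=> i; rewrite size_mkseq => ip; rewrite nth_mkseq //.
  by have := h i; rewrite /= mem_iota add0n => /(_ ip).
split.
  by rewrite SE; apply: fin_bigcap_measurable => // i _; apply: mX; exact: mB.
rewrite SE indep ?iota_uniq // -prodEFin -[in RHS](mkseq_nth c0 pre).
by rewrite big_map; apply: eq_bigr => i _; rewrite same // weight_fin.
Qed.

(** The law of the cells, conditionally on the first of them being [pre]: the
    induction on [n] splits the event according to the next cell, and the base
    case is the product rule. *)
Lemma prob_cells_from pre n (b : pred (seq {ffun A -> bool})) :
  let S := [set w | cells_of (size pre) w = pre /\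
                    b (cells_of (size pre + n) w)] in
  measurable S /\
  P S = (\prod_(c <- pre) weight c * prob weight n (fun s => b (pre ++ s)))%:E.
Proof using mE hiid.
elim: n pre => [|n IHn] pre /=.
  have [mS PS] := prob_prefix pre; rewrite addn0 /prob /= cats0.
  have [bp|bp] := boolP (b pre).
    rewrite mulr1 (_ : [set _ | _] = [set w | cells_of (size pre) w = pre]) //.
    by apply/seteqP; split => w /= => [[]|->].
  rewrite mulr0 (_ : [set _ | _] = set0) ?measure0 //.
  by apply/seteqP; split => // w /= [->]; rewrite (negbTE bp).
pose F c := [set w | cells_of (size (rcons pre c)) w = rcons pre c /\
                    b (cells_of (size (rcons pre c) + n) w)].
have SE : [set w | cells_of (size pre) w = pre /\
    b (cells_of (size pre + n.+1) w)]
    = \bigcup_(c in [set` index_enum {ffun A -> bool}]) F c.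
  have cR w k : cells_of k.+1 w = rcons (cells_of k w) (cell (xi k w)).
    by rewrite /cells_of mkseqS.
  apply/seteqP; split => w /=.
    move=> [wp bw]; exists (cell (xi (size pre) w)).
      by rewrite /= mem_index_enum.
    by rewrite /F /= size_rcons cR wp addSnnS.
  by move=> [c _]; rewrite /F /= size_rcons cR addSnnS => -[/rcons_inj[-> _]].
have mF c : measurable (F c) by have [] := IHn (rcons pre c).
split; first by rewrite SE; apply: fin_bigcup_measurable.
rewrite SE measure_fin_bigcup //; last first.
  move=> c c' _ _ [w [/= [h _] [h' _]]].
  move: h h'; rewrite !size_rcons => ->.
  by move=> /rcons_inj[].
rewrite -fsbig_seq ?index_enum_uniq // /prob /= mulr_sumr -sumEFin.
apply: eq_bigr => c _; have [_ ->] := IHn (rcons pre c).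
rewrite big_rcons /= -mulrA; congr (_ * (_ * _))%:E.
by apply: eq_expect => s _; rewrite cat_rcons.
Qed.

Lemma prob_cells n (b : pred (seq {ffun A -> bool})) :
  let S := [set w | b (cells_of n w)] in
  measurable S /\ P S = (prob weight n b)%:E.
Proof using mE hiid.
have := prob_cells_from [::] n b; rewrite /= big_nil mul1r.
rewrite (_ : [set w | _ /\ _] = [set w | b (cells_of n w)]) //.
by apply/seteqP; split => w //= [].
Qed.

Lemma sum_weight : \sum_c weight c = 1.
Proof using mE hiid.
have [_] := prob_cells 1 predT.
rewrite (_ : [set _ | _] = setT) ?probability_setT.
  by move=> [->]; rewrite /prob /=; apply: eq_bigr => c _; rewrite mulr1.
by apply/seteqP; split.
Qed.

End Cells.

Section ChainCounts.
Variables (R : realType) (dT : measure_display) (T : measurableType dT).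
Variables (P : probability T R) (d : Order.disp_t) (X : orderType d).
Variables (xi : nat -> T -> X) (hiid : iid P xi).
Variables (A : finType) (E : A -> set X).
Hypothesis mE : forall a, order_measurable (E a).
Hypothesis chainE : forall a b, E a `<=` E b \/ E b `<=` E a.

(** Only cells that are met by the order are retained, since otherwise the sets
    [cells_in a] need not form a chain when the sets [E a] do. *)
Definition cells_in (a : A) : {set {ffun A -> bool}} :=
  finset.finset (fun c => `[< exists2 x, E a x & c = cell E x >]).

Lemma cell_in a x : (cell E x \in cells_in a) = `[< E a x >].
Proof.
rewrite finset.in_set; apply/asboolP/asboolP => [[y Ey /ffunP/(_ a)]|Ex].
  by rewrite !ffunE; case: (asboolP (E a x)) => // _; case: asboolP.
by exists x.
Qed.

Lemma mass_cells_in a :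
  mass (weight P xi E) (cells_in a) = fine (P (xi 0%N @^-1` E a)).
Proof using mE hiid.
have [_] := prob_cells hiid mE 1 (fun s => has (mem (cells_in a)) s).
rewrite (_ : [set _ | _] = xi 0%N @^-1` E a); last first.
  by apply/seteqP; split => w; rewrite /= orbF cell_in => /asboolP.
move=> ->; rewrite /= /prob /= /mass [LHS]big_mkcond.
apply: eq_bigr => c _.
by rewrite orbF; case: (c \in cells_in a); rewrite ?mulr1 ?mulr0.
Qed.

Lemma chain_cells_in : chain (map cells_in (enum A)).
Proof using chainE.
have sub a b : E a `<=` E b -> cells_in a \subset cells_in b.
  move=> ab; apply/fintype.subsetP => c; rewrite !finset.in_set.
  by move=> /asboolP[x Ex ->]; apply/asboolP; exists x => //; apply: ab.
move=> _ _ /mapP[a _ ->] /mapP[b _ ->]; apply/orP.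
by have [/sub|/sub] := chainE a b; [left|right].
Qed.

(** The deviation inequality of [prob_block] for counts of the observations.  An
    empty [E a] is exempt from the hypotheses: it never catches the positive
    number [count_min a] of observations. *)
Lemma chain_counts (time count_min : A -> nat) (n : nat) (level dlt : R) :
    (0 < n)%N -> 0 < dlt < level -> (forall a, (time a <= n)%N) ->
    (forall a, E a !=set0 -> n%:R - (time a)%:R <= 4 * dlt ^+ 2 /\
       level <= (count_min a)%:R
                - (time a)%:R * fine (P (xi 0%N @^-1` E a))) ->
  let B := [set w | exists a, (0 < count_min a
     <= count (fun i => `[< E a (xi i w) >]) (iota 0 (time a)))%N] in
  measurable B /\
  (P B <= (2 * (expR (- (2 * (level - dlt) ^+ 2 / n%:R))
            + expR (- (11 / 6 * (level - dlt) ^+ 2 / n%:R))))%:E)%E.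
Proof using mE hiid chainE.
move=> n0 dl timen levelE B.
pose b s := [exists a, (0 < count_min a
                        <= count (mem (cells_in a)) (take (time a) s))%N].
have [] := prob_cells hiid mE n b.
rewrite (_ : [set w | b _] = B); last first.
  have cE w a : count (mem (cells_in a)) (take (time a) (cells_of xi E n w))
      = count (fun i => `[< E a (xi i w) >]) (iota 0 (time a)).
    rewrite /cells_of /mkseq -map_take take_iota (minn_idPl (timen a)) count_map.
    by apply: eq_count => i; rewrite /= cell_in.
  apply/seteqP; split => w /=.
    by move=> /existsP[a]; rewrite cE => h; exists a.
  by move=> [a h]; apply/existsP; exists a; rewrite cE.
move=> mH PH; split => //; rewrite PH lee_fin.
have p0 c : 0 <= weight P xi E c by exact: weight_ge0.
have p1 := sum_weight hiid mE.
apply: le_trans (prob_block p0 p1 n0 dl chain_cells_in).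
apply: le_prob => // s sn /existsP[a /andP[k0 ka]].
have [c cE] : exists c, c \in cells_in a.
  have : has (mem (cells_in a)) (take (time a) s).
    by rewrite has_count (leq_trans k0).
  by move=> /hasP[c _ ca]; exists c.
have /levelE[nt lev] : E a !=set0.
  by move: cE; rewrite finset.in_set => /asboolP[x Ex _]; exists x.
apply/hasP; exists (time a); first by rewrite mem_iota /= add0n ltnS.
rewrite nt; apply/hasP; exists (cells_in a); first by rewrite map_f ?mem_enum.
rewrite /dev size_takel ?sn // mass_cells_in.
by apply: le_trans lev _; rewrite lerB // ler_nat.
Qed.

End ChainCounts.

(** * Quantile crossings as counting events *)

Section Suprema.
Variables (d : Order.disp_t) (X : orderType d).
Hypothesis complete : complete_order X.
Implicit Types (A B : set X) (x b : X) (y : with_ends X).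

Lemma le_fin x b : (fin_elt x <= fin_elt b)%O = (x <= b)%O.
Proof. by []. Qed.

Lemma lt_fin x b : (fin_elt x < fin_elt b)%O = (x < b)%O.
Proof. by rewrite !ltNge. Qed.

Lemma supremums_fin A : A !=set0 -> supremums (@fin_elt d X @` A) !=set0.
Proof using complete.
move=> [a Aa].
have [bA|nbA] := pselect (ubound A !=set0).
  have [b [ubA lubA]] := complete (ex_intro _ a Aa) bA.
  exists (fin_elt b); split => [_ [x Ax <-]|[y||] uby] //; first exact: ubA.
    by apply: lubA => x Ax; exact: (uby (fin_elt x) (ex_intro2 _ _ x Ax erefl)).
  exact: (uby (fin_elt a) (ex_intro2 _ _ a Aa erefl)).
exists (@EPInf X : with_ends X); split => [_ [x Ax <-]|[y||] uby] //.
  case: nbA; exists y => x Ax.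
  exact: (uby (fin_elt x) (ex_intro2 _ _ x Ax erefl)).
exact: (uby (fin_elt a) (ex_intro2 _ _ a Aa erefl)).
Qed.

Lemma sup_in_supremums A : A !=set0 -> supremums (@fin_elt d X @` A) (sup_in A).
Proof using complete.
move=> A0; rewrite /sup_in /supremum ifF; last first.
  by apply/negbTE/set0P; have [a Aa] := A0; exists (fin_elt a), a.
by have [y Sy] := supremums_fin A0; apply: xgetPex; exists y.
Qed.

Lemma inf_space_infimums b :
  infimums (range (@fin_elt d X)) (inf_space X).
Proof.
rewrite /inf_space /infimum ifF; last first.
  by apply/negbTE/set0P; exists (fin_elt b), b.
apply: xgetPex; have [[z zmin]|nmin] := pselect (exists z, forall x, (z <= x)%O).
  exists (fin_elt z); split => [_ [x _ <-]|[y||] lby] //.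
  - exact: zmin.
  - exact: (lby (fin_elt z) (ex_intro2 _ _ z I erefl)).
  - exact: (lby (fin_elt z) (ex_intro2 _ _ z I erefl)).
exists (@ENInf X : with_ends X); split => [_ [x _ <-]|[y||] lby] //.
  case: nmin; exists y => x.
  exact: (lby (fin_elt x) (ex_intro2 _ _ x I erefl)).
exact: (lby (fin_elt b) (ex_intro2 _ _ b I erefl)).
Qed.

Lemma inf_space_le b : (inf_space X <= fin_elt b)%O.
Proof. by have [lb _] := inf_space_infimums b; apply: lb; exists b. Qed.

Lemma sup_in_ub A x : A x -> (fin_elt x <= sup_in A)%O.
Proof using complete.
move=> Ax; have [] := @sup_in_supremums A; first by exists x.
by move=> ub _; apply: ub; exists x.
Qed.

Lemma sup_in0 : sup_in (set0 : set X) = inf_space X.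
Proof. by rewrite /sup_in image_set0 supremum0. Qed.

Lemma sup_in_le A b : (forall x, A x -> (x <= b)%O) -> (sup_in A <= fin_elt b)%O.
Proof using complete.
move=> ubA; have [->|/set0P A0] := eqVneq A set0.
  by rewrite sup_in0 inf_space_le.
have [_ lub] := sup_in_supremums A0; apply: lub => _ [x Ax <-].
exact: ubA.
Qed.

Lemma sup_in_lt_sup_in A B :
  (sup_in B < sup_in A)%O <-> exists2 x, A x & (sup_in B < fin_elt x)%O.
Proof using complete.
split=> [BA|[x Ax Bx]]; last exact: lt_le_trans Bx (sup_in_ub Ax).
have [A0|/set0P A0] := eqVneq A set0.
  move: BA; rewrite A0 sup_in0; have [->|/set0P[b Bb]] := eqVneq B set0.
    by rewrite sup_in0 ltxx.
  by rewrite ltNge (le_trans (inf_space_le b)) // sup_in_ub.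
apply: contrapT => nA; have [_ lub] := sup_in_supremums A0.
have : (sup_in A <= sup_in B)%O.
  apply: lub => _ [x Ax <-]; rewrite leNgt; apply/negP => Bx; apply: nA.
  by exists x.
by rewrite leNgt BA.
Qed.

(** When [A] is empty its supremum is the infimum of the space, and an element
    strictly above that infimum has another one below it. *)
Lemma sup_in_lt A x : (sup_in A < fin_elt x)%O ->
  exists2 b, (b < x)%O & forall a, A a -> (a <= b)%O.
Proof using complete.
have [->|/set0P[a Aa]] := eqVneq A set0.
  rewrite sup_in0 => xm; apply: contrapT => nb.
  have [_ glb] := inf_space_infimums x; move: xm; rewrite ltNge => /negP; apply.
  apply: glb => _ [y _ <-]; rewrite le_fin leNgt; apply/negP => yx; apply: nb.
  by exists y.
have := sup_in_ub Aa; have := @sup_in_ub A; case: (sup_in A) => [b||] //= ub _.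
by rewrite (lt_fin b x) => bx; exists b => // y /ub.
Qed.

End Suprema.

(** Used to replace the cuts that catch the single observations of a sample by
    one cut that catches all of them. *)
Lemma directed_cover (Y B : Type) (S : set B) (D : B -> set Y) (f : nat -> Y)
    (s : seq nat) : S !=set0 ->
    (forall b c, S b -> S c ->
       exists2 e, S e & D b `<=` D e /\ D c `<=` D e) ->
  exists2 b, S b & forall i, i \in s -> (\bigcup_(c in S) D c) (f i) -> D b (f i).
Proof.
move=> S0 dir; elim: s => [|i s [b Sb bD]]; first by have [b Sb] := S0; exists b.
have [[c Sc Di]|nD] := pselect ((\bigcup_(c in S) D c) (f i)).
  have [e Se [be ce]] := dir b c Sb Sc; exists e => // j.
  rewrite in_cons => /orP[/eqP-> _|js Dj]; first exact: ce.
  by apply: be; apply: bD.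
by exists b => // j; rewrite in_cons => /orP[/eqP->|/bD].
Qed.

Section QuantileCounts.
Variables (R : realType) (dT : measure_display) (T : measurableType dT).
Variables (P : probability T R) (d : Order.disp_t) (X : orderType d).
Hypothesis complete : complete_order X.
Variables (xi : nat -> T -> X).
Hypotheses (hiid : iid P xi) (hF : cdf_continuous P (xi 0%N)).

Let F := cdf_of P (xi 0%N).

Definition hits (t : nat) (w : T) (D : set X) : nat :=
  count (fun i => `[< D (xi i w) >]) (iota 0 t).

Lemma empirical_hits t w x :
  empirical_cdf R xi t w x = t%:R^-1 * (hits t w [set z | (z <= x)%O])%:R.
Proof.
rewrite /empirical_cdf /hits -sum1_count natr_sum.
congr (_ * _); rewrite -(big_mkord xpredT (fun i => ((xi i w <= x)%O : bool)%:R)).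
rewrite /index_iota subn0.
by rewrite [RHS]big_mkcond; apply: eq_bigr => i _; rewrite asboolb;
  case: (_ <= _)%O.
Qed.

Lemma hits_le t w (D D' : set X) :
  (forall i, (i < t)%N -> D (xi i w) -> D' (xi i w)) ->
  (hits t w D <= hits t w D')%N.
Proof.
move=> DD'; rewrite /hits.
rewrite (@eq_in_count _ _ (predI (fun i => `[< D (xi i w) >]) (mem (iota 0 t)))).
  apply: sub_count => i /= /andP[/asboolP Di]; rewrite mem_iota add0n => it.
  exact/asboolP/DD'.
by move=> i /= ->; rewrite andbT.
Qed.

Lemma hitsC t w (D : set X) : (hits t w D + hits t w (~` D))%N = t.
Proof.
rewrite -[RHS](size_iota 0 t) -(count_predC (fun i => `[< D (xi i w) >])).
by congr (_ + _)%N; apply: eq_count => i /=; rewrite asbool_neg.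
Qed.

(** The upper band is crossed at level p when there are b < x with F x <= p such
    that the empirical distribution function exceeds p + g at every point above
    b: then more than t (p + g) observations are at most every point above b,
    that is, they are at most b or equal to a successor of b.  The cuts for the
    count j are the possible b with t (p + g) < j. *)
Definition upper_cuts (g : R) (t j : nat) : set X :=
  [set b | exists p x, [/\ 0 < p < 1, (b < x)%O, F x <= p
                         & t%:R * (p + g) < j%:R]].

Definition upper_segment (g : R) (t j : nat) : set X :=
  \bigcup_(b in upper_cuts g t j) [set z | forall y, (b < y)%O -> (z <= y)%O].

(** The lower band is crossed at level p when some x above the quantile of F at p
    has fewer than t (p - g) observations at most x, that is, more than
    t - t (p - g) above x; the cuts for a given count j are the possible x. *)
Definition lower_cuts (g : R) (t j : nat) : set X :=
  [set x | exists p, [/\ 0 < p < 1, (lower_quantile F p < fin_elt x)%O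
                       & t%:R - j%:R < t%:R * (p - g)]].

Definition lower_segment (g : R) (t j : nat) : set X :=
  \bigcup_(x in lower_cuts g t j) [set z | (x < z)%O].

(** From left to right, j is the number of observations caught by the cut at b.
    From right to left, the finitely many observations in the union over all
    cuts are caught by a single one, whose level p witnesses the crossing. *)
Lemma upper_quantile_hits (g : R) t w : (0 < t)%N -> 0 <= g ->
  (exists p, 0 < p < 1 /\
    (upper_quantile (empirical_cdf R xi t w) (p + g) < upper_quantile F p)%O)
  <-> exists j, (0 < j <= hits t w (upper_segment g t j))%N.
Proof using complete.
move=> t0 g0; have t0' : 0 < t%:R :> R by rewrite ltr0n.
split=> [[p [p01 /(sup_in_lt_sup_in complete)[x /= Fx]]]|[j /andP[j0 jh]]].
  move=> /(sup_in_lt complete)[b bx bub].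
  pose D b : set X := [set z | forall y, (b < y)%O -> (z <= y)%O].
  have [||y by' yD] := @directed_cover _ _ [set y | (b < y)%O]
      (fun y => [set z | (y < z)%O]) (xi^~ w) (iota 0 t).
  - by exists x.
  - move=> y y' /= by1 by2; exists (Order.min y y').
      by rewrite /= lt_min by1 by2.
    by split => z /=; rewrite gt_min => -> //; rewrite orbT.
  have hD : t%:R * (p + g) < (hits t w (D b))%:R.
    have : p + g < empirical_cdf R xi t w y.
      by rewrite ltNge; apply/negP => /bub; rewrite leNgt by'.
    rewrite empirical_hits mulrC ltr_pdivlMr // mulrC => /lt_le_trans; apply.
    rewrite ler_nat; apply: hits_le => i it /= zy y' by1.
    rewrite leNgt; apply/negP => y'z.
    move: zy; rewrite leNgt => /negP; apply; apply: yD.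
      by rewrite mem_iota.
    by exists y'.
  exists (hits t w (D b)); apply/andP; split.
    rewrite -(ltr0n R); apply: le_lt_trans hD; rewrite mulr_ge0 ?ltW //; lra.
  by apply: hits_le => i it Db; exists b => //; exists p, x.
have [||b [p [x [p01 bx Fx jp]]] bD] := @directed_cover _ _ (upper_cuts g t j)
   (fun b => [set z | forall y, (b < y)%O -> (z <= y)%O]) (xi^~ w) (iota 0 t).
- have : has (fun i => `[< upper_segment g t j (xi i w) >]) (iota 0 t).
    by rewrite has_count (leq_trans j0).
  by move=> /hasP[i _ /asboolP[b cb _]]; exists b.
- move=> b c Sb Sc; exists (Order.max b c).
    by rewrite /Order.max; case: ifP.
  by split => z h y; rewrite gt_max => /andP[? ?]; apply: h.
exists p; split => //; apply/(sup_in_lt_sup_in complete); exists x => //.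
apply: le_lt_trans (_ : fin_elt b < fin_elt x)%O; last by rewrite lt_fin.
apply: (sup_in_le complete) => y /=; rewrite empirical_hits => hy.
rewrite leNgt; apply/negP => by'; move: hy; apply/negP; rewrite -ltNge.
rewrite mulrC ltr_pdivlMr // mulrC; apply: lt_le_trans jp _.
rewrite ler_nat (leq_trans jh) //; apply: hits_le => i it /(bD i); apply.
  by rewrite mem_iota.
by [].
Qed.

Lemma lower_quantile_hits (g : R) t w : (0 < t)%N -> 0 <= g ->
  (exists p, 0 < p < 1 /\
    (lower_quantile F p < lower_quantile (empirical_cdf R xi t w) (p - g))%O)
  <-> exists j, (0 < j <= hits t w (lower_segment g t j))%N.
Proof using complete.
move=> t0 g0; have t0' : 0 < t%:R :> R by rewrite ltr0n.
have complE y : ~` [set z | (z <= y)%O] = [set z : X | (y < z)%O].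
  by apply/seteqP; split => z /=; rewrite ltNge => /negP.
have hitsE y : (hits t w [set z | (y < z)%O])%:R
    = t%:R - (hits t w [set z | (z <= y)%O])%:R :> R.
  rewrite -complE -{2}(hitsC t w [set z | (z <= y)%O]) natrD.
  by rewrite addrAC subrr add0r.
split=> [[p [p01 /(sup_in_lt_sup_in complete)[x /= + Fx]]]|[j /andP[j0 jh]]].
  rewrite empirical_hits mulrC ltr_pdivrMr // [ltRHS]mulrC => hx.
  exists (hits t w [set z | (x < z)%O]); apply/andP; split.
    by rewrite -(ltr0n R) hitsE; nra.
  apply: hits_le => i it xi_gt; exists x => //; exists p; split=> //.
  by rewrite hitsE opprB addrC subrK.
have [||x [p [p01 Fx jp]] xD] := @directed_cover _ _ (lower_cuts g t j)
   (fun x => [set z | (x < z)%O]) (xi^~ w) (iota 0 t).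
- have : has (fun i => `[< lower_segment g t j (xi i w) >]) (iota 0 t).
    by rewrite has_count (leq_trans j0).
  by move=> /hasP[i _ /asboolP[x cx _]]; exists x.
- move=> x y Sx Sy; exists (Order.min x y).
    by rewrite /Order.min; case: ifP.
  by split => z /=; rewrite gt_min => -> //; rewrite orbT.
exists p; split => //; apply/(sup_in_lt_sup_in complete); exists x => //=.
rewrite empirical_hits mulrC ltr_pdivrMr // [ltRHS]mulrC.
apply: le_lt_trans jp; rewrite lerBrDr -lerBrDl -hitsE ler_nat.
apply: (leq_trans jh); apply: hits_le => i it; apply: xD.
by rewrite mem_iota.
Qed.

Lemma upper_segment_down (g : R) t j : down_closed (upper_segment g t j).
Proof.
move=> x y xy [b Sb yb]; exists b => // z bz.
exact: le_trans xy (yb z bz).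
Qed.

Lemma lower_segment_up (g : R) t j : down_closed (~` lower_segment g t j).
Proof.
move=> x y xy nLy [b Sb bx]; apply: nLy; exists b => //.
exact: lt_le_trans bx xy.
Qed.

Lemma preimage_measurable i (D : set X) : down_closed D ->
  measurable (xi i @^-1` D).
Proof using complete hiid.
by move=> dD; have [mX _ _] := hiid; apply: mX; apply: down_closed_measurable.
Qed.

Lemma cdfE x : P [set w | (xi 0%N w <= x)%O] = (F x)%:E.
Proof using complete hiid.
rewrite /F /cdf_of fineK //; apply: fin_num_measure.
apply: (@preimage_measurable 0 [set z | (z <= x)%O]) => y z yz.
exact: le_trans.
Qed.

(** The segment is contained in the union of the rays up to x over all x with
    F x <= j / t - g; continuity of the law along this family bounds the
    probability of the union by the same number. *)
Lemma upper_segment_prob (g : R) t j : (0 < t)%N ->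
    upper_segment g t j !=set0 ->
  g * t%:R <= j%:R - t%:R * fine (P (xi 0%N @^-1` upper_segment g t j)).
Proof using complete hiid hF.
move=> t0 [z [b0 [p0 [x0 [p01 b0x0 Fx0 jp0]]] _]].
have t0' : 0 < t%:R :> R by rewrite ltr0n.
pose V := [set x | F x <= j%:R / t%:R - g].
have cutV p x : F x <= p -> t%:R * (p + g) < j%:R -> V x.
  move=> Fx; rewrite mulrC -ltr_pdivlMr // => jp; rewrite /V /=; lra.
have V0 : V !=set0 by exists x0; apply: cutV Fx0 jp0.
have mU : measurable (xi 0%N @^-1` upper_segment g t j).
  by apply: preimage_measurable; apply: upper_segment_down.
have mV : measurable (xi 0%N @^-1` \bigcup_(a in V) [set z | (z <= a)%O]).
  apply: preimage_measurable => y y' yy' [a Va ya]; exists a => //.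
  exact: le_trans yy' ya.
have : (P (xi 0%N @^-1` upper_segment g t j) <= (j%:R / t%:R - g)%:E)%E.
  apply: (@le_trans _ _ (P (\bigcup_(a in V) [set w | (xi 0%N w <= a)%O]))).
    rewrite preimage_bigcup in mV.
    apply: le_measure; rewrite ?inE // => w [b [p [x [_ bx Fx jp]]] /= h].
    by exists x; [exact: cutV Fx jp|exact: h].
  have [-> _] := hF V0; apply: ge_ereal_sup => _ [x Vx <-].
  by rewrite cdfE lee_fin.
rewrite -[P _]fineK ?fin_num_measure // lee_fin => /(ler_wpM2l (ltW t0')).
rewrite mulrBr mulrCA mulfV ?gt_eqF // mulr1; lra.
Qed.

(** The complement is the intersection of the rays up to x over all cuts x, at
    which F is at least 1 - j / t + g; continuity of the law along this family
    gives the same lower bound for the intersection. *)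
Lemma lower_segment_prob (g : R) t j : (0 < t)%N ->
    lower_segment g t j !=set0 ->
  g * t%:R <= j%:R - t%:R * fine (P (xi 0%N @^-1` lower_segment g t j)).
Proof using complete hiid hF.
move=> t0 [z [x0 x0S _]].
have t0' : 0 < t%:R :> R by rewrite ltr0n.
have mG : measurable (xi 0%N @^-1` (~` lower_segment g t j)).
  by apply: preimage_measurable; apply: lower_segment_up.
have GE : xi 0%N @^-1` (~` lower_segment g t j)
    = \bigcap_(x in lower_cuts g t j) [set w | (xi 0%N w <= x)%O].
  apply/seteqP; split => w /= h.
    by move=> x Sx /=; rewrite leNgt; apply/negP => xw; apply: h; exists x.
  by move=> [x Sx /=]; rewrite ltNge (h x Sx).
have : ((1 - j%:R / t%:R + g)%:E <= P (xi 0%N @^-1` (~` lower_segment g t j)))%E.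
  rewrite GE; have [_ ->] := hF (ex_intro _ x0 x0S).
  apply: le_ereal_inf_tmp => _ [x [p [p01 Fx jp]] <-].
  rewrite cdfE lee_fin; apply: (@le_trans _ _ p).
    move: jp; rewrite -ltr_pdivrMl // mulrBr mulVf ?gt_eqF // mulrC; lra.
  rewrite leNgt; apply/negP => xp; move: Fx; rewrite ltNge => /negP; apply.
  exact: (sup_in_ub complete).
have mL : measurable (xi 0%N @^-1` lower_segment g t j).
  by rewrite -[X in measurable X]setCK preimage_setC; apply: measurableC.
rewrite -preimage_setC probability_setC //.
rewrite -[P (xi 0%N @^-1` _)]fineK ?fin_num_measure //.
rewrite -EFinB lee_fin => /(ler_wpM2l (ltW t0')).
rewrite !mulrDr !mulrN mulrCA mulfV ?gt_eqF // !mulr1; lra.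
Qed.

End QuantileCounts.

(** * Summation over the epochs *)

Section Blocks.
Variables (R : realType) (dT : measure_display) (T : measurableType dT).
Variables (P : probability T R) (d : Order.disp_t) (X : orderType d).
Variables (xi : nat -> T -> X) (hiid : iid P xi).

(** One side of the band during the epoch from [u] to (50/49) u.  The number [n]
    is the last time of the epoch or just after it, and dlt = sqrt u / 14 is
    chosen so that 4 dlt^2 = u / 49 is the length of the epoch. *)
Lemma chain_block (seg : nat -> nat -> set X) (u level : R) :
    (forall t j, order_measurable (seg t j)) ->
    (forall t j t' j', seg t j `<=` seg t' j' \/ seg t' j' `<=` seg t j) ->
    1 <= u -> Num.sqrt u / 14 < level ->
    (forall t j, u <= t%:R < 50 / 49 * u -> seg t j !=set0 ->
       level <= j%:R - t%:R * fine (P (xi 0%N @^-1` seg t j))) ->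
  let B := [set w | exists t j, u <= t%:R < 50 / 49 * u /\
                                (0 < j <= hits xi t w (seg t j))%N] in
  measurable B /\
  (P B <= (2 * (expR (- (2 * (level - Num.sqrt u / 14) ^+ 2 / (50 / 49 * u)))
    + expR (- (11 / 6 * (level - Num.sqrt u / 14) ^+ 2 / (50 / 49 * u)))))%:E)%E.
Proof using hiid.
move=> mseg cseg u1 lev hseg B.
have u0 : 0 < u by lra.
pose dlt := Num.sqrt u / 14.
have dlt0 : 0 < dlt by rewrite divr_gt0 ?sqrtr_gt0.
have dlt2 : 4 * dlt ^+ 2 = 50 / 49 * u - u.
  by rewrite /dlt expr_div_n sqr_sqrtr ?ltW //; field.
pose n := Num.truncn (50 / 49 * u).
have qu0 : 0 <= 50 / 49 * u by lra.
have n_le : n%:R <= 50 / 49 * u by rewrite truncn_le.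
have n_gt0 : (0 < n)%N by rewrite truncn_ge_nat //=; lra.
have n0 : 0 < n%:R :> R by rewrite ltr0n.
pose inb (t : nat) : bool := u <= t%:R < 50 / 49 * u.
pose E (a : 'I_n.+1 * 'I_n.+1) : set X :=
  if inb a.1 then seg a.1 a.2 else set0.
have mE a : order_measurable (E a).
  by rewrite /E; case: ifP => _; [exact: mseg|exact: order_measurable0].
have cE a b : E a `<=` E b \/ E b `<=` E a.
  by rewrite /E; case: ifP => _; case: ifP => _; [exact: cseg|right|left|left].
have tn (a : 'I_n.+1 * 'I_n.+1) : (a.1 <= n)%N by rewrite -ltnS.
have [||mH PH] := @chain_counts R dT T P d X xi hiid _ E mE cE
  (fun a => a.1 : nat) (fun a => a.2 : nat) n level dlt n_gt0 _ tn.
- by rewrite dlt0.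
- move=> a; rewrite /E; case: ifP => [ina|_] [x Ex] //.
  split; last by apply: hseg => //; exists x.
  by rewrite dlt2; move/andP: ina => [? _]; lra.
have BE : B = [set w | exists a : 'I_n.+1 * 'I_n.+1, (0 < (a.2 : nat)
     <= count (fun i => `[< E a (xi i w) >]) (iota 0 a.1))%N].
  apply/seteqP; split => w /=.
    move=> [t [j [tu /andP[j0 jh]]]].
    have tln : (t < n.+1)%N.
      by rewrite ltnS /n truncn_ge_nat // ltW //; have /andP[] := tu.
    have jln : (j < n.+1)%N.
      apply: leq_ltn_trans tln; apply: leq_trans jh _.
      by rewrite /hits (leq_trans (count_size _ _)) // size_iota.
    exists (Ordinal tln, Ordinal jln) => /=; rewrite j0 /E /= /inb tu /=.
    exact: jh.
  move=> [[t j] /= /andP[j0]]; rewrite /E /=; case: ifP => [tu jh|_ jh].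
    by exists t, j; rewrite j0.
  have : has (fun i => `[< set0 (xi i w) >]) (iota 0 t).
    by rewrite has_count; apply: leq_trans j0 jh.
  by move=> /hasP[i _ /asboolP].
rewrite BE; split => //; apply: le_trans PH _.
rewrite lee_fin ler_pM2l // -/dlt.
have sq := sqr_ge0 (level - dlt).
have inv : (50 / 49 * u)^-1 <= n%:R^-1.
  by rewrite lef_pV2 // posrE; lra.
apply: lerD; rewrite ler_expR lerN2 ler_wpM2l // mulr_ge0 //.
Qed.

End Blocks.

Lemma down_closed_chain (d : Order.disp_t) (X : orderType d) (A B : set X) :
  down_closed A -> down_closed B -> A `<=` B \/ B `<=` A.
Proof.
move=> dA dB; have [|nAB] := pselect (A `<=` B); first by left.
right=> y By; apply: contrapT => nAy; apply: nAB => x Ax.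
apply: (dB x y) => //; rewrite leNgt; apply/negP => yx; apply: nAy.
exact: (dA y x (ltW yx)).
Qed.

Section Summation.
Variable R : realType.

(** Comparison with the integral of y^(-(s + 1)): each term is at most the
    increment of - (50 / s) y^(-s) between consecutive values of
    y = 1 + k / 50. *)
Lemma sum_epochs (s : R) (n : nat) : 0 < s ->
  \sum_(k < n) expR (- (s + 1) * ln (1 + k%:R / 50)) <= 1 + 50 / s.
Proof.
move=> s0; pose y k : R := 1 + k%:R / 50.
have y0 k : 0 < y k by have := ler0n R k; rewrite /y; lra.
suff H : forall m, \sum_(k < m.+1) expR (- (s + 1) * ln (y k))
    <= 1 + 50 / s - 50 / s * expR (- s * ln (y m)).
  case: n => [|n]; first by rewrite big_ord0 addr_ge0 // divr_ge0 // ltW.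
  apply: le_trans (H n) _; rewrite gerBl.
  by apply: mulr_ge0; rewrite ?expR_ge0 // divr_ge0 // ltW.
elim=> [|m IHm].
  by rewrite big_ord1 /y mul0r addr0 ln1 !mulr0 expR0; lra.
rewrite big_ord_recr /=; apply: le_trans (lerD IHm (lexx _)) _.
have ym := y0 m; have ym1 := y0 m.+1.
have ys : y m.+1 = y m + 50^-1 by rewrite /y -natr1; ring.
have step : expR (- s * ln (y m.+1)) * (1 + s / 50 * (y m.+1)^-1)
    <= expR (- s * ln (y m)).
  have -> : - s * ln (y m) = - s * ln (y m.+1)
      + s * - ln (y m / y m.+1) by rewrite ln_div ?posrE //; ring.
  rewrite expRD ler_wpM2l ?expR_ge0 //; apply: le_trans (expR_ge1Dx _).
  rewrite lerD2l -[leLHS]mulrA; apply: ler_wpM2l; first exact: ltW.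
  rewrite lerNr.
  have -> : y m / y m.+1 = 1 + - (50^-1 * (y m.+1)^-1).
    by rewrite ys; field; rewrite gt_eqF //; lra.
  apply: le_ln1Dx.
  rewrite ltrN2 -invfM invf_lt1; last by rewrite mulr_gt0.
  by have := ler0n R m.+1; rewrite /y; lra.
have -> : expR (- (s + 1) * ln (y m.+1))
    = expR (- s * ln (y m.+1)) * (y m.+1)^-1.
  rewrite mulNr mulrDl mul1r opprD expRD -mulNr; congr (_ * _).
  by rewrite expRN lnK ?posrE.
move: step; rewrite mulrDr mulr1.
set a := expR _; set b := expR _; set z := (y m.+1)^-1 => step.
have : a * z <= 50 / s * (b - a).
  have -> : a * z = 50 / s * (a * (s / 50 * z)) by field; rewrite gt_eqF.
  by apply: ler_wpM2l; [rewrite divr_ge0 // ltW|lra].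
lra.
Qed.

(** The tangent of the concave square root near c = 7 turns the quadratic in
    sqrt c into an affine lower bound in c. *)
Lemma block_exponent (c : R) : 0 <= c ->
  1371 / 1000 * c - 306 / 1000
    <= 2 * (85 / 100 * Num.sqrt c - 14^-1) ^+ 2 / (50 / 49).
Proof.
move=> c0; rewrite -{1}(sqr_sqrtr c0); have := sqrtr_ge0 c.
set y := Num.sqrt c => y0.
(* 2.64 is close to sqrt 7. *)
by have := sqr_ge0 (y - 264 / 100); lra.
Qed.

(** Both slopes exceed 1.25, so the ratio of the two sides decreases in C, and
    exp x >= 1 + x suffices at C = 7. *)
Lemma numeric_bound (C : R) : 7 <= C ->
  4 * (expR (306 / 1000 - 1371 / 1000 * C) * (1 + 50 / (371 / 1000))
     + expR (281 / 1000 - 1256 / 1000 * C) * (1 + 50 / (256 / 1000)))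
    <= 1612 * expR (- (125 / 100 * C)).
Proof.
move=> C7.
have -> : 306 / 1000 - 1371 / 1000 * C =
  - (125 / 100 * C) - (121 / 1000 * C - 306 / 1000) by field.
have -> : 281 / 1000 - 1256 / 1000 * C =
  - (125 / 100 * C) - (6 / 1000 * C - 281 / 1000) by field.
rewrite !expRD; set e := expR (- (125 / 100 * C)).
have e0 : 0 <= e by apply: expR_ge0.
have h1 : expR (- (121 / 1000 * C - 306 / 1000)) <= 65 / 100.
  rewrite expRN -[leLHS]mul1r ler_pdivrMr ?expR_gt0 //.
  by have := expR_ge1Dx (121 / 1000 * C - 306 / 1000); lra.
have h2 : expR (- (6 / 1000 * C - 281 / 1000)) <= 132 / 100.
  rewrite expRN -[leLHS]mul1r ler_pdivrMr ?expR_gt0 //.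
  by have := expR_ge1Dx (6 / 1000 * C - 281 / 1000); lra.
have := ler_wpM2l e0 h1; have := ler_wpM2l e0 h2.
set a := e * _; set b := e * expR _ => hb ha; lra.
Qed.

Lemma epoch_exists (m : R) (t : nat) : 1 <= m -> m <= t%:R ->
  exists k, m * (50 / 49) ^+ k <= t%:R < 50 / 49 * (m * (50 / 49) ^+ k).
Proof.
move=> m1 mt.
have q1 : 0 < 50 / 49 :> R by lra.
have bern k : 1 + k%:R / 49 <= (50 / 49 : R) ^+ k.
  elim: k => [|k IHk]; first by rewrite expr0 mul0r addr0.
  rewrite exprS; apply: le_trans (ler_wpM2l (ltW q1) IHk).
  by have := ler0n R k; rewrite -natr1; lra.
have ex : exists k, t%:R < m * (50 / 49 : R) ^+ k.+1.
  exists (49 * t)%N; apply: lt_le_trans (_ : 1 + (49 * t).+1%:R / 49 <= _).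
    by rewrite -natr1 natrM; lra.
  apply: le_trans (bern _) _; rewrite ler_peMl // exprn_ge0 ?ltW //.
have [k tk kmin] := ex_minnP ex.
exists k; rewrite mulrCA -exprS tk andbT.
case: k kmin {tk} => [|k] kmin; first by rewrite expr0 mulr1.
rewrite leNgt; apply/negP => tk.
by have := kmin k tk; rewrite ltnn.
Qed.

End Summation.

Section Assembly.
Variable R : realType.
Implicit Types (m C : R) (k t : nat).

Lemma bigcup_le (dT : measure_display) (T : measurableType dT)
    (P : probability T R) (B : nat -> set T) (b : nat -> R) (K : R) :
    (forall k, measurable (B k)) -> (forall k, P (B k) <= (b k)%:E)%E ->
    (forall n, \sum_(k < n) b k <= K) ->
  (P (\bigcup_k B k) <= K%:E)%E.
Proof.
move=> mB Bb bK.
apply: le_trans (measure_sigma_subadditive P mB (bigcupT_measurable B mB) _) _.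
  exact: subset_refl.
apply: lime_le; first exact: is_cvg_nneseries.
apply: nearW => n; rewrite big_mkord.
apply: (@le_trans _ _ (\sum_(k < n) (b k)%:E)%E).
  by apply: lee_sum => k _; exact: Bb.
by rewrite sumEFin lee_fin.
Qed.

Definition epoch (m : R) (k : nat) : R := m * (50 / 49) ^+ k.

(** A lower bound, during epoch k, for log log (e t / m) + C: log (50/49) is at
    least 1/50. *)
Definition budget (C : R) (k : nat) : R := C + ln (1 + k%:R / 50).

Definition epoch_level (m C : R) (k : nat) : R :=
  85 / 100 * (Num.sqrt (epoch m k) * Num.sqrt (budget C k)).

Lemma epoch_ge1 m k : 1 <= m -> 1 <= epoch m k.
Proof.
move=> m1; rewrite /epoch mulr_ege1 // exprn_ege1 //; lra.
Qed.

Lemma budget_ge C k : C <= budget C k.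
Proof.
by rewrite /budget lerDl ln_ge0 // lerDl divr_ge0.
Qed.

Lemma radius_ge0 m C t : 0 <= radius m C t.
Proof. by rewrite /radius mulr_ge0 ?sqrtr_ge0 //; lra. Qed.

Lemma budget_le m C k (t : nat) : 1 <= m -> epoch m k <= t%:R ->
  budget C k <= ln (ln (expR 1 * t%:R / m)) + C.
Proof.
move=> m1 kt; have m0 : 0 < m by lra.
have u0 : 0 < epoch m k by have := epoch_ge1 k m1; lra.
have t0 : 0 < t%:R :> R by lra.
have q0 : 0 < 50 / 49 :> R by lra.
rewrite /budget addrC lerD2r.
have y0 : 0 < 1 + k%:R / 50 :> R by have := ler0n R k; lra.
suff h : 1 + k%:R / 50 <= ln (expR 1 * t%:R / m).
  by rewrite ler_ln ?posrE //; lra.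
rewrite -mulrA lnM ?posrE ?expR_gt0 ?divr_gt0 // expRK lerD2l.
apply: (@le_trans _ _ (ln ((50 / 49) ^+ k))).
  rewrite lnXn // -[leRHS]mulr_natl. apply: ler_wpM2l => //.
  have : ln (1 + - 50^-1) <= - 50^-1 :> R by apply: le_ln1Dx; lra.
  have -> : 1 + - 50^-1 = (50 / 49)^-1 :> R by field.
  by rewrite lnV ?posrE // lerN2.
rewrite ler_ln ?posrE ?exprn_gt0 ?divr_gt0 //.
by rewrite ler_pdivlMr // mulrC.
Qed.

(** t g_t = 0.85 sqrt (t (log log (e t / m) + C)), and both factors under the root
    only grow after the start of the epoch. *)
Lemma radius_level m C k (t : nat) : 1 <= m -> 7 <= C -> epoch m k <= t%:R ->
  epoch_level m C k <= radius m C t * t%:R.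
Proof.
move=> m1 C7 kt; have u1 := epoch_ge1 k m1.
have t0 : 0 < t%:R :> R by lra.
have b7 := budget_ge C k.
rewrite /epoch_level /radius -[leRHS]mulrA; apply: ler_wpM2l; first lra.
rewrite -sqrtrM; last lra.
have tE : t%:R = Num.sqrt (t%:R ^+ 2) :> R by rewrite sqrtr_sqr gtr0_norm.
rewrite [X in _ <= _ * X]tE.
have Z := budget_le C m1 kt.
rewrite -sqrtrM; last by rewrite mulr_ge0 ?invr_ge0 //; lra.
apply: ler_wsqrtr; set z := ln _ + C in Z *.
have -> : t%:R^-1 * z * t%:R ^+ 2 = t%:R * z by field; rewrite gt_eqF.
by apply: ler_pM => //; lra.
Qed.

Lemma epoch_level_gt m C k : 1 <= m -> 7 <= C ->
  Num.sqrt (epoch m k) / 14 < epoch_level m C k.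
Proof.
move=> m1 C7; have u1 := epoch_ge1 k m1.
have s0 : 0 < Num.sqrt (epoch m k) by rewrite sqrtr_gt0; lra.
have b1 : 1 <= Num.sqrt (budget C k).
  by rewrite -[leLHS]sqrtr1 ler_wsqrtr //; have := budget_ge C k; lra.
by rewrite /epoch_level; nra.
Qed.

(** The second term has 11/12 of the exponent of the first, rounded down to
    three digits; the factors depending on k are powers of 1 + k / 50. *)
Definition epoch_bound (C : R) (k : nat) : R :=
  expR (306 / 1000 - 1371 / 1000 * C)
    * expR (- (371 / 1000 + 1) * ln (1 + k%:R / 50))
  + expR (281 / 1000 - 1256 / 1000 * C)
    * expR (- (256 / 1000 + 1) * ln (1 + k%:R / 50)).

Lemma epoch_exponents m C k : 1 <= m -> 7 <= C ->
  expR (- (2 * (epoch_level m C k - Num.sqrt (epoch m k) / 14) ^+ 2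
             / (50 / 49 * epoch m k)))
  + expR (- (11 / 6 * (epoch_level m C k - Num.sqrt (epoch m k) / 14) ^+ 2
             / (50 / 49 * epoch m k)))
    <= epoch_bound C k.
Proof.
move=> m1 C7; set u := epoch m k; set D := epoch_level m C k - _; 
have u1 : 1 <= u := epoch_ge1 k m1.
have b7 := budget_ge C k; have b0 : 0 <= budget C k by lra.
have l0 : 0 <= ln (1 + k%:R / 50) :> R by rewrite ln_ge0 // lerDl divr_ge0.
have DE a : a * D ^+ 2 / (50 / 49 * u) =
    a / 2 * (2 * (85 / 100 * Num.sqrt (budget C k) - 14^-1) ^+ 2 / (50 / 49)).
  have -> : D = Num.sqrt u * (85 / 100 * Num.sqrt (budget C k) - 14^-1).
    by rewrite /D /epoch_level -/u; ring.
  rewrite exprMn sqr_sqrtr; last lra.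
  by field; rewrite gt_eqF //; lra.
rewrite !DE; have := block_exponent b0; set w := _ / (50 / 49) => hw.
rewrite /epoch_bound -!expRD; apply: lerD; rewrite ler_expR;
  move: hw b7 l0; rewrite /budget; set L := ln _ => hw b7 l0; lra.
Qed.

Lemma sum_epoch_bound (C : R) (n : nat) : 7 <= C ->
  \sum_(k < n) 4 * epoch_bound C k <= 1612 * expR (- (125 / 100 * C)).
Proof.
move=> C7; apply: le_trans (numeric_bound C7).
rewrite -mulr_sumr ler_wpM2l // big_split /= -!mulr_sumr.
have h1 : 0 < 371 / 1000 :> R by lra.
have h2 : 0 < 256 / 1000 :> R by lra.
apply: lerD; apply: ler_wpM2l; first exact: expR_ge0.
- exact: (sum_epochs n h1).
- exact: expR_ge0.
- exact: (sum_epochs n h2).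
Qed.

End Assembly.

Theorem corollary2 (R : realType)
  (dT : measure_display) (T : measurableType dT) (P : probability T R)
  (d : Order.disp_t) (X : orderType d) (hX : complete_order X)
  (xi : nat -> T -> X) (hiid : iid P xi) (hF : cdf_continuous P (xi 0%N))
  (m C : R) (hm : 1 <= m) (hC : 7 <= C) :
  let F := cdf_of P (xi 0%N) in
  let Fhat := empirical_cdf R xi in
  let g := radius m C in
  let bad : set T := [set w | exists (t : nat) (p : R),
    [/\ m <= t%:R, 0 < p < 1 &
      (lower_quantile F p < lower_quantile (Fhat t w) (p - g t))%O \/
      (upper_quantile F p > upper_quantile (Fhat t w) (p + g t))%O]] in
  (P bad <= (1612 * expR (- (125 / 100 * C)))%:E)%E.
Proof.
cbv zeta; set bad := (X in P X); pose g := radius m C.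
pose upper t j := upper_segment P xi (g t) t j.
pose lower t j := lower_segment P xi (g t) t j.
pose B (seg : nat -> nat -> set X) k := [set w | exists t j,
  epoch m k <= t%:R < 50 / 49 * epoch m k /\ (0 < j <= hits xi t w (seg t j))%N].
have t_gt0 (t : nat) : m <= t%:R -> (0 < t)%N by rewrite -(ltr0n R); lra.
have badE : bad = \bigcup_k (B upper k `|` B lower k).
  apply/seteqP; split => w /=.
    move=> [t [p [mt p01 lu]]]; have [k tk] := epoch_exists hm mt.
    exists k => //; case: lu => h; [right|left].
      have [+ _] := lower_quantile_hits P hX xi w (t_gt0 t mt) (radius_ge0 m C t).
      by move=> /(_ (ex_intro _ p (conj p01 h)))[j jh]; exists t, j.
    have [+ _] := upper_quantile_hits P hX xi w (t_gt0 t mt) (radius_ge0 m C t).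
    by move=> /(_ (ex_intro _ p (conj p01 h)))[j jh]; exists t, j.
  have m_le k : m <= epoch m k.
    by rewrite /epoch ler_peMr ?exprn_ege1 //; lra.
  move=> [k _ [|] [t [j [/andP[kt _] jh]]]]; have mt := le_trans (m_le k) kt.
    have [_] := upper_quantile_hits P hX xi w (t_gt0 t mt) (radius_ge0 m C t).
    by move=> /(_ (ex_intro _ j jh))[p [p01 h]]; exists t, p; split=> //; right.
  have [_] := lower_quantile_hits P hX xi w (t_gt0 t mt) (radius_ge0 m C t).
  by move=> /(_ (ex_intro _ j jh))[p [p01 h]]; exists t, p; split=> //; left.
(* Both sides in one epoch; they differ only in the family of segments. *)
have block seg k : (forall t j, order_measurable (seg t j)) ->
    (forall t j t' j', seg t j `<=` seg t' j' \/ seg t' j' `<=` seg t j) ->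
    (forall t j, (0 < t)%N -> seg t j !=set0 ->
       g t * t%:R <= j%:R - t%:R * fine (P (xi 0%N @^-1` seg t j))) ->
    measurable (B seg k) /\ (P (B seg k) <= (2 * epoch_bound C k)%:E)%E.
  move=> mseg cseg hseg; have u1 := epoch_ge1 k hm.
  have [|mB PB] := chain_block hiid mseg cseg u1 (epoch_level_gt k hm hC).
    move=> t j /andP[kt _] sn; apply: le_trans (radius_level hm hC kt) _.
    by apply: hseg => //; rewrite -(ltr0n R); lra.
  split=> //; apply: le_trans PB _; rewrite lee_fin ler_pM2l //.
  exact: epoch_exponents.
have up k : measurable (B upper k) /\
    (P (B upper k) <= (2 * epoch_bound C k)%:E)%E.
  apply: block => [t j|t j t' j'|t j t0 ne].
  - by apply: (down_closed_measurable hX); apply: upper_segment_down.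
  - by apply: down_closed_chain; apply: upper_segment_down.
  - exact: upper_segment_prob.
have lo k : measurable (B lower k) /\
    (P (B lower k) <= (2 * epoch_bound C k)%:E)%E.
  apply: block => [t j|t j t' j'|t j t0 ne].
  - rewrite -[lower t j]setCK; apply: order_measurableC.
    by apply: (down_closed_measurable hX); apply: lower_segment_up.
  - have [/subsetC|/subsetC] := down_closed_chain
      (@lower_segment_up _ _ _ P _ _ xi (g t) t j)
      (@lower_segment_up _ _ _ P _ _ xi (g t') t' j').
      by rewrite !setCK; right.
    by rewrite !setCK; left.
  - exact: lower_segment_prob.
rewrite badE; apply: (bigcup_le (b := fun k => 4 * epoch_bound C k)) => [k|k|n].
- by apply: measurableU; [case: (up k)|case: (lo k)].
- have [mU PU] := up k; have [mL PL] := lo k.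
  apply: le_trans (measureU2 _ mU mL) _.
  by apply: le_trans (leeD PU PL) _; rewrite -EFinD lee_fin; lra.
- exact: sum_epoch_bound.
Qed.
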